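(* Let $M$ be a connected elementary split matroid of rank $k$ on an $n$-element ground set $E$, where $n\ge 4$, and let $e\in E$ be such that $M\setminus e$ and $M/e$ are both connected. Let $v\in E\setminus\{e\}$ and let $\prec$ be a total order on $E$. The matroid $N_{e,v,\prec}$ described in the context has Speyer $g$-polynomial \[ g_{N_{e,v,\prec}}(t) =g_{\mathsf{U}_{k-1,n-2}}(t) -\sum_{F\in\mathcal{I}_e}\mathcal{C}_{r_F-1,\,k-1,\,h_F-2,\,n-2}(t) -\sum_{F\in\mathcal{O}_e}\mathcal{C}_{r_F,\,k-1,\,h_F,\,n-2}(t). \] In particular, for fixed $M$ and $e$, the $g$-polynomial of $N_{e,v,\prec}$ is independent of the choice of $v$ and of the total order $\prec$.
   Context: All matroids are finite, and connected matroids are required to have nonempty ground sets. $\mathsf{U}_{k,n}$ is the uniform matroid of rank $k$ on $n$ elements. **Cyclic flats.** A subset of the ground set of a matroid is cyclic if it is a (possibly empty) union of circuits; a cyclic flat is a flat that is cyclic. If $M$ is loopless and coloopless with ground set $E$, the cyclic flats other than $\varnothing$ and $E$ are called proper, and $\mathcal{Z}^{\circ}(M)$ is the set of proper cyclic flats. A loopless, coloopless matroid is elementary split if and only if its proper cyclic flats are pairwise incomparable under inclusion. A matroid is determined by its cyclic flats and their ranks. **Parameters.** For $F\in\mathcal{Z}^{\circ}(M)$ write $r_F=\operatorname{rk}_M(F)$, $h_F=|F|$, $p_F=k-r_F$, $b_F=h_F-r_F$, and let \[ \mathcal{I}_e=\{F\in\mathcal{Z}^{\circ}(M): e\in F,\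 b_F\ge 2\},\qquad \mathcal{O}_e=\{F\in\mathcal{Z}^{\circ}(M): e\notin F,\ p_F\ge 2\}. \] **The matroid $N_{e,v,\prec}$.** Minima are taken with respect to $\prec$. For $F\in\mathcal{I}_e$ put $s_F=r_F-1$, $x_F=\min(F\setminus\{e\})$, and $R_F=F\setminus\{e,v\}$ if $v\in F$, $R_F=F\setminus\{e,x_F\}$ if $v\notin F$. For $F\in\mathcal{O}_e$ put $s_F=r_F$, $y_F=\min(E\setminus(F\cup\{e\}))$, and $R_F=F$ if $v\notin F$, $R_F=(F\setminus\{v\})\cup\{y_F\}$ if $v\in F$. Then $N_{e,v,\prec}$ is the connected elementary split matroid of rank $k-1$ on $E\setminus\{e,v\}$ whose proper cyclic flats are exactly the sets $R_F$ ($F\in\mathcal{I}_e\sqcup\mathcal{O}_e$), with $R_F$ having rank $s_F$. (Such a matroid exists under the stated hypotheses and is unique.) **Speyer's $g$-polynomial.** A connected series-parallel matroid on at least two elements is a matroid obtained from $\mathsf{U}_{1,2}$ by successive series and parallel extensions; a parallel extension adds a new element parallel to an existing nonloop element, and a series extension is the dual operation. The base polytope $P(M)\subset\mathbb{R}^{E}$ is the convex hull of the indicator vectors of the bases of $M$. Speyer's $g$-polynomial is the unique matroid (isomorphism) invariant $M\mapsto g_M(t)\in\mathbb{Z}[t]$ such that: (i) $g_M(t)=0$ if $M$ has a loop or a coloop; (ii) $g_M(t)=t$ if $M$ is a connected series-parallel matroid on at least two elements; (iii) $g_{M_1\oplus M_2}(t)=g_{M_1}(t)g_{M_2}(t)$;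 (iv) $g$ is covaluative: for every polyhedral subdivision $\mathcal{S}$ of $P(M)$ all of whose cells are matroid base polytopes, $g_M(t)=\sum_{P(N)\in\mathcal{S}^{\circ}} g_N(t)$, where $\mathcal{S}^{\circ}$ is the collection of all cells (of every dimension) not contained in the relative boundary of $P(M)$. **Correction polynomials.** Let $r,k,h,n$ be integers with $r\ge1$, $p:=k-r\ge1$, $b:=h-r\ge1$, $a:=n-k-h+r\ge1$. The cuspidal matroid $\Lambda_{r,k,h,n}$ of rank $k$ on $n$ elements is, up to isomorphism, the following lattice path matroid on $\{1,\dots,n\}$. Write $\mathsf{N}=(0,1)$ and $\mathsf{E}=(1,0)$ for north and east steps, and write paths starting at $(0,0)$ as words in these steps, with powers denoting repeated steps. The bases are the sets of positions of the north steps in those north-east lattice paths from $(0,0)$ to $(n-k,k)$ that stay weakly below the upper path $\mathsf{N}^p\mathsf{E}^a\mathsf{N}^r\mathsf{E}^b$ and weakly above the lower path $\mathsf{E}^{n-k}\mathsf{N}^k$. Then \[ \mathcal{C}_{r,k,h,n}(t):=g_{\Lambda_{r,k,h,n}}(t)+g_{\mathsf{U}_{r,h}}(t)\,g_{\mathsf{U}_{k-r,\,n-h}}(t). \] *)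

(* Defs.v *)
From HB Require Import structures.
From mathcomp Require Import boolp classical_sets reals.
From mathcomp Require Import all_boot all_order all_algebra.

Set Implicit Arguments.
Unset Strict Implicit.
Unset Printing Implicit Defensive.

Import Order.TTheory GRing.Theory Num.Theory.

Local Open Scope nat_scope.

(* Matroids, given by their bases.  The ground set is a subset of a finite    *)
(* type, so that minors of a matroid live on the same type.                   *)
Record matroid (T : finType) := Matroid {
  ground : {set T};
  bases : {set {set T}};
  bases_sub : forall B, B \in bases -> B \subset ground;
  bases_neq0 : exists B, B \in bases;
  bases_exchange : forall B1 B2 x, B1 \in bases -> B2 \in bases ->
    x \in B1 :\: B2 -> exists2 y, y \in B2 :\: B1 & y |: (B1 :\ x) \in bases
}.

Section MatroidBasics.
Variables (T : finType) (M : matroid T).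
Implicit Types (A B C F : {set T}) (x y : T).

Definition rk A : nat := \max_(B in bases M) #|A :&: B|.

Definition mrank : nat := rk (ground M).

Definition indep A : bool := [exists B in bases M, A \subset B].

Definition circuit C : bool :=
  minset (fun A => (A \subset ground M) && ~~ indep A) C.

Definition loop x : bool :=
  (x \in ground M) && [forall B in bases M, x \notin B].

Definition coloop x : bool :=
  (x \in ground M) && [forall B in bases M, x \in B].

Definition flat F : bool :=
  (F \subset ground M) && [forall x in ground M :\: F, rk F < rk (x |: F)].

Definition cyclic A : bool :=
  [exists S : {set {set T}}, [forall C in S, circuit C] && (cover S == A)].

Definition proper_cyclic_flats : {set {set T}} :=
  [set F | [&& flat F, cyclic F, F != set0 & F != ground M]].

Definition connected : bool :=
  (ground M != set0) &&
  [forall x in ground M, forall y in ground M, (x != y) ==>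
    [exists C, [&& circuit C, x \in C & y \in C]]].

(* Only meaningful for loopless and coloopless matroids, in particular for    *)
(* connected matroids with at least two elements.                             *)
Definition elementary_split : bool :=
  [forall F in proper_cyclic_flats, forall G in proper_cyclic_flats,
    (F \subset G) ==> (F == G)].

End MatroidBasics.

Lemma card_exchange (T : finType) (B : {set T}) x y :
  x \in B -> y \notin B -> #|y |: (B :\ x)| = #|B|.
Proof.
move=> xB yB; rewrite cardsU1 (cardsD1 x B) xB.
by rewrite !inE (negbTE yB) andbF.
Qed.

Lemma card_bases (T : finType) (M : matroid T) B1 B2 :
  B1 \in bases M -> B2 \in bases M -> #|B1| = #|B2|.
Proof.
have le B3 B4 : B3 \in bases M -> B4 \in bases M -> #|B3| <= #|B4|.
  have [m] := ubnP #|B3 :\: B4|; elim: m B3 => // m IHm B3 ltm B3M B4M.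
  have [/eqP|[x xB]] := set_0Vmem (B3 :\: B4).
    by rewrite setD_eq0; apply: subset_leq_card.
  have [y yB BM] := bases_exchange B3M B4M xB.
  move: (xB) (yB); rewrite !inE => /andP[xB4 xB3] /andP[yB3 yB4].
  rewrite -(card_exchange xB3 yB3); apply: IHm => //.
  rewrite -ltnS; apply: leq_trans ltm; rewrite ltnS; apply: proper_card.
  apply/properP; split.
    apply/subsetP => z; rewrite !inE => /andP[zB4 /orP[/eqP zy|/andP[_ ->]]].
      by rewrite zy yB4 in zB4.
    by rewrite zB4.
  exists x => //; rewrite !inE eqxx /= orbF.
  by apply/negP => /andP[_ /eqP xy]; rewrite -xy xB3 in yB3.
by move=> B1M B2M; apply/eqP; rewrite eqn_leq !le.
Qed.

Lemma bases_coexchange (T : finType) (M : matroid T) B1 B2 x :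
  B1 \in bases M -> B2 \in bases M -> x \in B2 :\: B1 ->
  exists2 y, y \in B1 :\: B2 & x |: (B1 :\ y) \in bases M.
Proof.
move=> B1M B2M; rewrite inE => /andP[xB1 xB2].
pose P B := [&& B \in bases M, x \in B & B1 :&: B2 \subset B].
have P2 : P B2 by rewrite /P B2M xB2 subsetIr.
have [B /and3P[BM xB sB] maxB] := @arg_maxnP _ B2 P (fun B => #|B :&: B1|) P2.
have sBx : B \subset x |: B1.
  apply/subsetP => z zB; rewrite !inE; apply/negPn/negP.
  rewrite negb_or => /andP[zx zB1].
  have zD : z \in B :\: B1 by rewrite inE zB1.
  have [w /[!inE] /andP[wB wB1] wM] := bases_exchange BM B1M zD.
  have := maxB (w |: (B :\ z)); rewrite /P wM /= !inE xB [x == z]eq_sym zx orbT /=.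
  have -> : B1 :&: B2 \subset w |: B :\ z.
    apply/subsetP => u uI; rewrite !inE (subsetP sB _ uI) andbT.
    by case: (u =P z) uI => [->|]; rewrite ?orbT // inE (negbTE zB1).
  move=> /(_ isT); apply/negP; rewrite -ltnNge; apply: proper_card.
  apply/properP; split.
    apply/subsetP => u /setIP[uB uB1]; rewrite !inE uB uB1 !andbT.
    by case: (u =P z) uB1 => [->|]; rewrite ?orbT // (negbTE zB1).
  by exists w; rewrite !inE ?eqxx ?wB1 // (negbTE wB).
have cB := card_bases BM B1M.
have : #|(x |: B1) :\: B| == 1.
  by rewrite cardsD (setIidPr sBx) cB cardsU1 xB1 addnK.
case/cards1P => y defy.
have : y \in (x |: B1) :\: B by rewrite defy set11.
rewrite !inE => /andP[yB /orP[/eqP yx|yB1]]; first by rewrite yx xB in yB.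
exists y.
  rewrite inE yB1 andbT; apply: contra yB => yB2.
  by apply: (subsetP sB); rewrite inE yB1.
suff -> : x |: (B1 :\ y) = B by [].
apply/setP => u; have := in_set1 u y; rewrite -defy !inE.
have := subsetP sBx u; rewrite !inE.
case: (u =P x) => [->|_] /=; first by rewrite xB.
by case: (u \in B) => /= [/(_ isT) ->|_ _] //; case: (u \in B1).
Qed.

Section Dual.
Variables (T : finType) (M : matroid T).

Let dbases := [set ground M :\: B | B in bases M].

Fact dual_sub B : B \in dbases -> B \subset ground M.
Proof. by case/imsetP => B' _ ->; apply: subsetDl. Qed.

Fact dual_neq0 : exists B, B \in dbases.
Proof. by have [B BM] := bases_neq0 M; exists (ground M :\: B); apply: imset_f. Qed.

Fact dual_exchange B1 B2 x : B1 \in dbases -> B2 \in dbases ->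
  x \in B1 :\: B2 -> exists2 y, y \in B2 :\: B1 & y |: (B1 :\ x) \in dbases.
Proof.
case/imsetP => A1 A1M -> /imsetP[A2 A2M ->]; rewrite !inE => /andP[+ /andP[xA1 xE]].
rewrite xE andbT negbK => xA2.
have xD : x \in A2 :\: A1 by rewrite inE xA1.
have [y /[!inE] /andP[yA2 yA1] AM] := bases_coexchange A1M A2M xD.
have yE := subsetP (bases_sub A1M) _ yA1.
exists y; first by rewrite !inE yA1 yA2 yE.
apply/imsetP; exists (x |: A1 :\ y) => //; apply/setP => u; rewrite !inE.
case: (u =P y) => [->|_] /=.
  by rewrite yE orbF andbT; case: (y =P x) => // yx; rewrite yx xA2 in yA2.
by rewrite negb_or andbA.
Qed.

Definition dual : matroid T := Matroid dual_sub dual_neq0 dual_exchange.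

End Dual.

Section Restriction.
Variables (T : finType) (M : matroid T) (A : {set T}).

Let rbases := [set A :&: B | B in bases M & #|A :&: B| == rk M A].

Fact restrict_sub B : B \in rbases -> B \subset ground M :&: A.
Proof.
case/imsetP => B' /[!inE] /andP[B'M _] ->.
by rewrite setIC; apply: setSI; apply: bases_sub.
Qed.

Fact restrict_neq0 : exists B, B \in rbases.
Proof.
have [B0 B0M] := bases_neq0 M.
have [B BM rkB] := @eq_bigmax_cond _ [in bases M] (fun B => #|A :&: B|)
  (introT card_gt0P (ex_intro _ B0 B0M)).
by exists (A :&: B); apply: imset_f; rewrite inE /rk rkB eqxx andbT.
Qed.

Fact restrict_exchange B1 B2 x : B1 \in rbases -> B2 \in rbases ->
  x \in B1 :\: B2 -> exists2 y, y \in B2 :\: B1 & y |: (B1 :\ x) \in rbases.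
Proof.
case/imsetP => C1 /[!inE] /andP[C1M /eqP c1] -> /imsetP[C2 /[!inE] /andP[C2M c2] ->].
have lerk C : C \in bases M -> #|A :&: C| <= rk M A.
  by move=> CM; exact: (@leq_bigmax_cond _ [in bases M] (fun B => #|A :&: B|)).
pose P C := (C \in bases M) && (A :&: C == A :&: C2).
have P2 : P C2 by rewrite /P C2M eqxx.
have [C /andP[CM /eqP trC] maxC] := @arg_maxnP _ C2 P (fun C => #|C :&: C1|) P2.
have sC u : u \in C -> u \notin C1 -> u \in A.
  move=> uC uC1; apply/negPn/negP => uA.
  have uD : u \in C :\: C1 by rewrite inE uC1.
  have [w /[!inE] /andP[wC wC1] wM] := bases_exchange CM C1M uD.
  have wA : w \notin A.
    apply/negP => wA; have := lerk _ wM; rewrite -(eqP c2) -trC.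
    apply/negP; rewrite -ltnNge; apply: proper_card; apply/properP; split.
      apply/subsetP => z /setIP[zA zC]; rewrite !inE zA zC andbT /=.
      by case: (z =P u) zA => [->|]; rewrite ?orbT // (negbTE uA).
    by exists w; rewrite !inE ?wA ?eqxx //= (negbTE wC).
  have := maxC (w |: (C :\ u)); rewrite /P wM /=.
  have -> : A :&: (w |: C :\ u) = A :&: C2.
    rewrite -trC; apply/setP => z; rewrite !inE.
    case zA: (z \in A) => //=; case: (z =P w) zA => [->|_ zA] /=.
      by rewrite (negbTE wA).
    by case: (z =P u) zA => [->|//]; rewrite (negbTE uA).
  rewrite eqxx => /(_ isT); apply/negP; rewrite -ltnNge; apply: proper_card.
  apply/properP; split.
    apply/subsetP => z /setIP[zC zC1]; rewrite !inE zC zC1 !andbT.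
    by case: (z =P u) zC1 => [->|]; rewrite ?orbT // (negbTE uC1).
  by exists w; rewrite !inE ?eqxx ?wC1 // (negbTE wC).
rewrite -trC !inE => /andP[xC /andP[xA xC1]]; rewrite xA /= in xC.
have xD : x \in C1 :\: C by rewrite inE xC.
have [y /[!inE] /andP[yC1 yC] CM'] := bases_exchange C1M CM xD.
have yA := sC _ yC yC1.
exists y; first by rewrite !inE (negbTE yC1) andbF yA yC.
have e : A :&: (y |: (C1 :\ x)) = y |: ((A :&: C1) :\ x).
  apply/setP => z; rewrite !inE; case: (z =P y) => [->|_] /=.
    by rewrite yA.
  by rewrite andbCA.
rewrite -e; apply: imset_f; rewrite inE CM' e card_exchange ?c1 ?eqxx //.
  by rewrite inE xA.
by rewrite inE (negbTE yC1) andbF.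
Qed.

Definition restrict : matroid T :=
  Matroid restrict_sub restrict_neq0 restrict_exchange.

End Restriction.

Definition delete (T : finType) (M : matroid T) (e : T) : matroid T :=
  restrict M (ground M :\ e).

Definition contract (T : finType) (M : matroid T) (e : T) : matroid T :=
  dual (delete (dual M) e).

Section DirectSum.
Variables (T1 T2 : finType) (M1 : matroid T1) (M2 : matroid T2).

Definition sum_set (A1 : {set T1}) (A2 : {set T2}) : {set T1 + T2} :=
  (inl @: A1) :|: (inr @: A2).

Lemma sum_set_inl A1 A2 x : (inl x \in sum_set A1 A2) = (x \in A1).
Proof.
rewrite inE mem_imset; last by move=> ? ? [].
by case: imsetP => [[]//|]; rewrite orbF.
Qed.

Lemma sum_set_inr A1 A2 x : (inr x \in sum_set A1 A2) = (x \in A2).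
Proof.
rewrite inE orbC mem_imset; last by move=> ? ? [].
by case: imsetP => [[]//|]; rewrite orbF.
Qed.

Let sbases := [set sum_set B1 B2 | B1 in bases M1, B2 in bases M2].

Fact dsum_sub B : B \in sbases -> B \subset sum_set (ground M1) (ground M2).
Proof.
case/imset2P => B1 B2 /bases_sub/subsetP s1 /bases_sub/subsetP s2 ->.
apply/subsetP => -[x|x]; rewrite ?sum_set_inl ?sum_set_inr; [exact: s1|exact: s2].
Qed.

Fact dsum_neq0 : exists B, B \in sbases.
Proof.
have [B1 B1M] := bases_neq0 M1; have [B2 B2M] := bases_neq0 M2.
by exists (sum_set B1 B2); apply: imset2_f.
Qed.

Fact dsum_exchange B1 B2 x : B1 \in sbases -> B2 \in sbases ->
  x \in B1 :\: B2 -> exists2 y, y \in B2 :\: B1 & y |: (B1 :\ x) \in sbases.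
Proof.
case/imset2P => A1 A2 A1M A2M -> /imset2P[C1 C2 C1M C2M ->].
case: x => x; rewrite inE ?sum_set_inl ?sum_set_inr -in_setD => xD.
  have [y yD yM] := bases_exchange A1M C1M xD.
  exists (inl y); first by rewrite inE !sum_set_inl -in_setD.
  apply/imset2P; exists (y |: (A1 :\ x)) A2 => //.
  by apply/setP => -[z|z]; rewrite !(sum_set_inl, sum_set_inr, in_setU1, in_setD1).
have [y yD yM] := bases_exchange A2M C2M xD.
exists (inr y); first by rewrite inE !sum_set_inr -in_setD.
apply/imset2P; exists A1 (y |: (A2 :\ x)) => //.
by apply/setP => -[z|z]; rewrite !(sum_set_inl, sum_set_inr, in_setU1, in_setD1).
Qed.

Definition dsum : matroid (T1 + T2)%type :=
  Matroid dsum_sub dsum_neq0 dsum_exchange.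

End DirectSum.

Section Uniform.
Variables k n : nat.

Let ubases := [set B : {set 'I_n} | #|B| == minn k n].

Fact uniform_sub B : B \in ubases -> B \subset [set: 'I_n].
Proof. by rewrite subsetT. Qed.

Fact uniform_neq0 : exists B, B \in ubases.
Proof.
have le : minn k n <= n by apply: geq_minr.
exists (widen_ord le @: [set: 'I_(minn k n)]); rewrite inE card_imset.
  by rewrite cardsT card_ord.
by move=> i j /(congr1 val) /= /val_inj.
Qed.

Fact uniform_exchange B1 B2 x : B1 \in ubases -> B2 \in ubases ->
  x \in B1 :\: B2 -> exists2 y, y \in B2 :\: B1 & y |: (B1 :\ x) \in ubases.
Proof.
rewrite !inE => /eqP c1 /eqP c2 /andP[xB2 xB1].
have [/eqP|[y yD]] := set_0Vmem (B2 :\: B1).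
  rewrite setD_eq0 => s; have := subset_cardP (etrans c2 (esym c1)) s.
  by move=> /(_ x); rewrite xB1 (negbTE xB2).
exists y => //; move: yD; rewrite !inE => /andP[yB1 _].
by rewrite card_exchange ?c1.
Qed.

(* [k] is truncated to [n] when [n < k]. *)
Definition uniform : matroid 'I_n :=
  Matroid uniform_sub uniform_neq0 uniform_exchange.

End Uniform.

(* A lattice path is the word of its steps, [true] being a north step and     *)
(* [false] an east step.                                                      *)
Definition height (w : seq bool) (i : nat) : nat := count id (take i w).

(* For two paths starting at the origin: after every number of steps, the     *)
(* first one has made at most as many north steps as the second one.          *)
Definition weakly_below (w u : seq bool) : bool :=
  [forall i : 'I_(size u).+1, height w i <= height u i].

Definition north_steps n (w : n.-tuple bool) : {set 'I_n} :=
  [set i | tnth w i].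

Lemma height_card n (w : n.-tuple bool) i :
  height w i = #|[set j in north_steps w | j < i]|.
Proof.
rewrite /height; elim: i => [|i IHi].
  by rewrite take0 /=; apply/esym/eqP; rewrite cards_eq0; apply/eqP/setP => j;
     rewrite !inE andbF.
have [lein|lin] := ltnP i n; last first.
  move: IHi; rewrite !take_oversize ?size_tuple // => [->|]; last exact: leqW.
  apply: eq_card => j; rewrite !inE.
  by rewrite !(leq_trans (ltn_ord j)) // leqW.
rewrite (take_nth false) ?size_tuple // -cats1 count_cat IHi /= addn0.
rewrite (cardsD1 (Ordinal lein) [set j in north_steps w | j < i.+1]) addnC.
congr (_ + _); first by rewrite !inE /= ltnSn andbT (tnth_nth false).
apply: eq_card => j; rewrite !inE ltnS [j <= i]leq_eqVlt -val_eqE /=.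
by case: ltngtP; rewrite ?andbF ?andbT.
Qed.

Lemma north_steps_inj n : injective (@north_steps n).
Proof.
move=> w w' /setP e; apply: eq_from_tnth => i.
by have := e i; rewrite !inE.
Qed.

Lemma north_steps_surj n (B : {set 'I_n}) :
  north_steps [tuple i \in B | i < n] = B.
Proof. by apply/setP => i; rewrite inE tnth_mktuple. Qed.

Section Cuspidal.
Variables p a r b : nat.

Let n := p + a + r + b.
Let k := p + r.

Definition cuspidal_upper : seq bool :=
  nseq p true ++ nseq a false ++ nseq r true ++ nseq b false.

Definition cuspidal_lower : seq bool := nseq (a + b) false ++ nseq (p + r) true.

Definition cuspidal_bases : {set {set 'I_(p + a + r + b)}} :=
  [set north_steps w | w : (p + a + r + b).-tuple bool &
    [&& count id w == p + r,
        weakly_below w cuspidal_upper & weakly_below cuspidal_lower w]].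

Let size_upper : size cuspidal_upper = n.
Proof. by rewrite !size_cat !size_nseq !addnA. Qed.

Let count_upper : count id cuspidal_upper = k.
Proof. by rewrite !count_cat !count_nseq /= !mul0n !mul1n addn0 add0n. Qed.

Let nE : n = a + b + k.
Proof. by rewrite /n /k addnAC -[p + a + b]addnA [p + (a + b)]addnC addnA. Qed.

Lemma cuspidal_lower_below (w : n.-tuple bool) :
  count id w = k -> weakly_below cuspidal_lower w.
Proof.
move=> cw; apply/forallP => -[i /=]; rewrite ltnS size_tuple => lein.
rewrite /height /cuspidal_lower take_cat size_nseq.
have := cw; rewrite -{1}(cat_take_drop i w) count_cat => cw'.
have := count_size id (drop i w); rewrite size_drop size_tuple => ced.
case: ltnP => [lt|ge].
  by rewrite take_nseq ?(ltnW lt) // count_nseq mul0n.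
rewrite count_cat count_nseq mul0n add0n take_nseq; last first.
  by rewrite leq_subLR -nE.
rewrite count_nseq mul1n -(leq_add2r (count id (drop i w))) cw'.
apply: leq_trans (leq_add (leqnn _) ced) _.
by rewrite addnBAC // subnKC // leq_subLR -nE.
Qed.

Lemma cuspidal_basesP (B : {set 'I_n}) :
  reflect (#|B| = k /\
           forall i, i <= n -> #|[set j in B | j < i]| <= height cuspidal_upper i)
          (B \in cuspidal_bases).
Proof.
have cE (w : n.-tuple bool) : count id w = #|north_steps w|.
  have := height_card w n; rewrite /height take_oversize ?size_tuple // => ->.
  by apply: eq_card => j; rewrite !inE ltn_ord andbT.
apply: (iffP imsetP) => [[w /[!inE] /and3P[/eqP cw /forallP up _] ->]|[cB up]].
  split; first by rewrite -cE.
  move=> i lein; rewrite -height_card.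
  have lti : i < (size cuspidal_upper).+1 by rewrite size_upper ltnS.
  exact: (up (Ordinal lti)).
have := north_steps_surj B; move: [tuple _ | _ < n] => w wB.
exists w; last by rewrite wB.
have cw : count id w = k by rewrite cE wB.
rewrite inE cw eqxx (cuspidal_lower_below cw) andbT.
apply/forallP => -[i /=]; rewrite ltnS size_upper => lein.
by rewrite height_card wB up.
Qed.

Fact cuspidal_sub B : B \in cuspidal_bases -> B \subset [set: 'I_n].
Proof. by rewrite subsetT. Qed.

Fact cuspidal_neq0 : exists B, B \in cuspidal_bases.
Proof.
have sz : size cuspidal_upper == n by rewrite size_upper.
exists (north_steps (Tuple sz)); apply: imset_f.
rewrite inE /= count_upper eqxx /=; apply/andP; split.
  by apply/forallP => i.
by apply: (@cuspidal_lower_below (Tuple sz)).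
Qed.

Fact cuspidal_exchange B1 B2 x :
  B1 \in cuspidal_bases -> B2 \in cuspidal_bases ->
  x \in B1 :\: B2 ->
  exists2 y, y \in B2 :\: B1 & y |: (B1 :\ x) \in cuspidal_bases.
Proof.
move=> /cuspidal_basesP[c1 u1] /cuspidal_basesP[c2 u2] /[!inE] /andP[xB2 xB1].
have [/eqP|[y0 y0D]] := set_0Vmem (B2 :\: B1).
  rewrite setD_eq0 => s; have := subset_cardP (etrans c2 (esym c1)) s.
  by move=> /(_ x); rewrite xB1 (negbTE xB2).
have [y yD ymax] := @arg_maxnP _ y0 [in B2 :\: B1] (@nat_of_ord n) y0D.
exists y => //; move: yD; rewrite inE => /andP[yB1 yB2].
apply/cuspidal_basesP; split; first by rewrite card_exchange.
move=> i lein.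
have [leyi|ltiy] := ltnP y i; last first.
  apply: leq_trans (u1 i lein); apply/subset_leq_card/subsetP => z.
  rewrite !inE => /andP[/orP[/eqP ->|/andP[_ ->]]] //=.
  by rewrite ltnNge ltiy.
have [lexi|ltix] := ltnP x i.
  apply: leq_trans (u1 i lein).
  have -> : [set j in y |: B1 :\ x | j < i] = y |: ([set j in B1 | j < i] :\ x).
    apply/setP => z; rewrite !inE; case: (z =P y) => [->|_] /=; first by rewrite leyi.
    by rewrite andbA.
  by rewrite card_exchange // !inE ?xB1 ?lexi // (negbTE yB1).
apply: leq_trans (u2 i lein).
have cardE (B : {set 'I_n}) : #|[set j in B | j < i]| + #|[set j in B | i <= j]| = #|B|.
  rewrite -(cardsID [set j : 'I_n | j < i] B); congr (_ + _).
    by apply: eq_card => j; rewrite !inE.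
  by apply: eq_card => j; rewrite !inE -leqNgt andbC.
rewrite -(leq_add2r #|[set j in B2 | i <= j]|) cardE c2.
rewrite -c1 -(card_exchange xB1 yB1) -(cardE (y |: B1 :\ x)) leq_add2l.
apply/subset_leq_card/subsetP => z; rewrite !inE => /andP[zB2 leiz].
rewrite leiz andbT; apply/orP; right; apply/andP; split.
  by apply: contraNneq xB2 => <-.
apply/negPn/negP => zB1.
have := ymax z; rewrite inE zB1 zB2 => /(_ isT) /=; rewrite leqNgt => /negP; apply.
exact: leq_trans leyi leiz.
Qed.

(* The matroid Lambda_{r,k,h,n} with k = p + r, h = r + b, n = p + a + r + b. *)
Definition cuspidal : matroid 'I_(p + a + r + b) :=
  Matroid cuspidal_sub cuspidal_neq0 cuspidal_exchange.

End Cuspidal.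

Definition matroid_iso (T1 T2 : finType) (M1 : matroid T1) (M2 : matroid T2) :
    Prop :=
  exists f : T1 -> T2,
    [/\ {in ground M1 &, injective f},
        f @: ground M1 = ground M2 &
        [set f @: B | B : {set T1} in bases M1] = bases M2].

(* [{x, y}] being a circuit of [M] (resp. of its dual) says that [M] is a     *)
(* parallel extension of [delete M x] (resp. a series extension of            *)
(* [contract M x]) by the new element [x].                                    *)
Inductive series_parallel (T : finType) : matroid T -> Prop :=
| SP_base M : matroid_iso M (uniform 1 2) -> series_parallel M
| SP_parallel M x y : x != y -> circuit M [set x; y] ->
    series_parallel (delete M x) -> series_parallel M
| SP_series M x y : x != y -> circuit (dual M) [set x; y] ->
    series_parallel (contract M x) -> series_parallel M.

Local Open Scope ring_scope.

Section Polytopes.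
Variables (R : realType) (T : finType).
Implicit Types (P F : set (T -> R)) (M : matroid T).

Definition lincomb m (c : 'I_m -> R) (u : 'I_m -> T -> R) : T -> R :=
  fun t => \sum_(i < m) c i * u i t.

Definition convex_hull P : set (T -> R) :=
  fun x => exists (m : nat) (c : 'I_m -> R) (u : 'I_m -> T -> R),
    [/\ forall i, P (u i), forall i, 0 <= c i, \sum_i c i = 1 & x = lincomb c u].

Definition affine_hull P : set (T -> R) :=
  fun x => exists (m : nat) (c : 'I_m -> R) (u : 'I_m -> T -> R),
    [/\ forall i, P (u i), \sum_i c i = 1 & x = lincomb c u].

Definition rel_interior P : set (T -> R) :=
  fun x => P x /\ exists2 d : R, 0 < d &
    forall y, affine_hull P y -> (forall t, `|y t - x t| < d) -> P y.

(* For a closed [P], such as a polytope. *)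
Definition rel_boundary P : set (T -> R) :=
  fun x => P x /\ ~ rel_interior P x.

(* Nonempty faces of a nonempty polytope. *)
Definition face P F : Prop :=
  exists c : T -> R, F = (fun x => P x /\
    forall y, P y -> \sum_t c t * y t <= \sum_t c t * x t).

Definition indicator (A : {set T}) : T -> R := fun t => (t \in A)%:R.

(* The polytope lives in the coordinate subspace of the ground set. *)
Definition base_polytope M : set (T -> R) :=
  convex_hull (fun x => exists2 B, B \in bases M & x = indicator B).

Definition matroid_subdivision M (I : finType) (N : I -> matroid T) : Prop :=
  [/\ forall i, ground (N i) = ground M,
      injective (fun i => base_polytope (N i)),
      forall x, base_polytope M x <-> exists i, base_polytope (N i) x,
      forall i F, face (base_polytope (N i)) F ->
        exists j, F = base_polytope (N j) &
      forall i j,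
        let Q := (base_polytope (N i) `&` base_polytope (N j))%classic in
        Q <> classical_sets.set0 ->
        face (base_polytope (N i)) Q /\ face (base_polytope (N j)) Q].

Definition interior_cell M N : Prop :=
  ~ (base_polytope N `<=` rel_boundary (base_polytope M))%classic.

End Polytopes.

Definition matroid_function := forall T : finType, matroid T -> {poly int}.

(* Exactly one function satisfies this record; the real field [R] only serves *)
(* to speak about polytopes.                                                  *)
Record is_speyer_g (R : realType) (g : matroid_function) : Prop := IsSpeyerG {
  speyer_iso : forall (T1 T2 : finType) (M1 : matroid T1) (M2 : matroid T2),
    matroid_iso M1 M2 -> g T1 M1 = g T2 M2;
  speyer_loop : forall (T : finType) (M : matroid T) (x : T),
    loop M x || coloop M x -> g T M = 0;
  speyer_series_parallel : forall (T : finType) (M : matroid T),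
    series_parallel M -> g T M = 'X;
  speyer_dsum : forall (T1 T2 : finType) (M1 : matroid T1) (M2 : matroid T2),
    g _ (dsum M1 M2) = g T1 M1 * g T2 M2;
  speyer_covaluative : forall (T : finType) (M : matroid T)
      (I : finType) (N : I -> matroid T),
    matroid_subdivision R M N ->
    g T M = \sum_(i | `[< interior_cell R M (N i) >]) g T (N i)
}.

(* Meant for r >= 1, k - r >= 1, h - r >= 1 and n - k - h + r >= 1, so that   *)
(* none of the subtractions below is truncated.                               *)
Definition correction (g : matroid_function) (r k h n : nat) : {poly int} :=
  g _ (cuspidal (k - r) (n + r - (k + h)) r (h - r)) +
  g _ (uniform r h) * g _ (uniform (k - r) (n - h)).

Local Open Scope nat_scope.

(* The ground set E totally ordered by the non-strict form of the order.      *)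
Definition total_order_on (T : finType) (E : {set T}) (le : rel T) : Prop :=
  [/\ {in E &, total le}, {in E &, antisymmetric le} & {in E & &, transitive le}].

(* The default value [x0] is only used for an empty [A]. *)
Definition min_elt (T : finType) (le : rel T) (x0 : T) (A : {set T}) : T :=
  odflt x0 [pick x in A | [forall y in A, le x y]].

Section Reduction.
Variables (T : finType) (M : matroid T) (e : T).

Definition inner_flats : {set {set T}} :=
  [set F in proper_cyclic_flats M | (e \in F) && (2 <= #|F| - rk M F)].

Definition outer_flats : {set {set T}} :=
  [set F in proper_cyclic_flats M | (e \notin F) && (2 <= mrank M - rk M F)].

Variables (v : T) (le : rel T).

Definition reduced_flat (F : {set T}) : {set T} :=
  if e \in F then
    if v \in F then F :\: [set e; v]
    else F :\: [set e; min_elt le e (F :\ e)]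
  else
    if v \in F then
      min_elt le e (ground M :\: (e |: F)) |: (F :\ v)
    else F.

Definition reduced_rank (F : {set T}) : nat :=
  if e \in F then (rk M F).-1 else rk M F.

Definition is_reduction (N : matroid T) : Prop :=
  let flats := inner_flats :|: outer_flats in
  [/\ ground N = ground M :\: [set e; v],
      connected N && elementary_split N,
      mrank N = (mrank M).-1,
      proper_cyclic_flats N = [set reduced_flat F | F : {set T} in flats] &
      forall F, F \in flats -> rk N (reduced_flat F) = reduced_rank F].

End Reduction.

(* Main.v *)
Require Import Defs.
From mathcomp Require Import boolp classical_sets reals.
From mathcomp Require Import all_boot all_order all_algebra.
From mathcomp Require Import zify ring lra.

(** The matroid N enters only through its proper cyclic flats, so the formula
is an instance of one valid for every connected elementary split matroid N of
rank K on a set E with m >= 2 elements: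
    g_N = g_U - sum over the proper cyclic flats F of
                  (g_Lambda(F) + g_U(r_F, h_F) * g_U(K - r_F, m - h_F)),
where U is uniform of rank K on E.  Geometrically, the base polytope of N is
what is left of the hypersimplex when, for each proper cyclic flat F, the part
beyond the hyperplane x(F) = r_F is cut off.  The part cut off is the polytope
of a cuspidal matroid, the common facet is the polytope of a direct sum of two
uniform matroids, and covaluativity charges exactly these two cells.

The cuts do not interfere: distinct proper cyclic flats F and G satisfy
    |F :&: G| + K <= r_F + r_G                                  (pcf_pair)
because F :&: G is independent and F :|: G spans.  As
x(F) + x(G) = x(F :|: G) + x(F :&: G) <= K + |F :&: G| on the hypersimplex, with
equality in its interior only if F and G partition E, and as the inequality is
strict for a partition when N is connected (pcf_strict_pair), two of the
hyperplanes can only meet on the boundary.  The flats are therefore cut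
off one at a time (speyer_cut), each time subdividing a polytope by a single
hyperplane (speyer_hyperplane_split).  Three facts carry this.

- Families of sets of size K bounded on a system of such cuts are base families
  (cut_symmetric_exchange), and so are their subfamilies of maximal weight,
  which are the faces (heaviest_symmetric_exchange, face_hull).

- Cutting the polytope creates no new vertices: the solutions of the
  inequalities are convex combinations of the bases satisfying them (cut_hull).
  A fractional solution is moved both ways along a difference of two unit
  vectors that preserves every tight inequality, until a further inequality
  becomes tight.

- The cells of the subdivision that meet the relative interior are the two
  parts and their common facet (interior_heaviest): a linear functional that is
  maximal over one part at a point interior to the whole is constant on the
  hyperplane section through that point.

Finally the assignment of reduced flats to flats of M is injective
(reduced_flat_inj), by pcf_pair in M, so that the sum over the proper cyclic
flats of N is a sum over flats of M whose ranks and sizes are known. *)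

Set Implicit Arguments.
Unset Strict Implicit.
Unset Printing Implicit Defensive.
Import Order.TTheory GRing.Theory Num.Theory.
Local Open Scope nat_scope.

(** * Rank, closure and cyclic sets *)

Section MatroidRank.
Variables (T : finType) (M : matroid T).
Implicit Types (A B C D I J F G : {set T}) (x y : T).

Lemma rk_ge A B : B \in bases M -> #|A :&: B| <= rk M A.
Proof. by move=> BM; exact: (@leq_bigmax_cond _ [in bases M] (fun B => #|A :&: B|)). Qed.

Lemma rk_attained A : exists2 B, B \in bases M & #|A :&: B| = rk M A.
Proof.
have [B0 B0M] := bases_neq0 M.
have [B BM rkB] := @eq_bigmax_cond _ [in bases M] (fun B => #|A :&: B|)
  (introT card_gt0P (ex_intro _ B0 B0M)).
by exists B.
Qed.

Lemma rk_le A n : (forall B, B \in bases M -> #|A :&: B| <= n) -> rk M A <= n.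
Proof. by move=> le; have [B BM <-] := rk_attained A; apply: le. Qed.

Lemma rk_card A : rk M A <= #|A|.
Proof. by apply: rk_le => B _; apply/subset_leq_card/subsetIl. Qed.

Lemma rkS A C : A \subset C -> rk M A <= rk M C.
Proof.
move=> sAC; have [B BM <-] := rk_attained A.
by apply: leq_trans (rk_ge C BM); apply/subset_leq_card/setSI.
Qed.

Lemma mrank_card B : B \in bases M -> mrank M = #|B|.
Proof.
move=> BM; rewrite /mrank; have [C CM <-] := rk_attained (ground M).
by rewrite (setIidPr (bases_sub CM)); apply: card_bases CM BM.
Qed.

Lemma rk_mrank A : rk M A <= mrank M.
Proof.
have [B BM <-] := rk_attained A.
by rewrite (mrank_card BM); apply/subset_leq_card/subsetIr.
Qed.

Lemma indepP I : reflect (exists2 B, B \in bases M & I \subset B) (indep M I).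
Proof. by apply: (iffP existsP) => [[B /andP[]]|[B ? ?]]; exists B => //; apply/andP. Qed.

Lemma indepS I J : I \subset J -> indep M J -> indep M I.
Proof. by move=> sIJ /indepP[B BM sJB]; apply/indepP; exists B => //; apply: subset_trans sJB. Qed.

Lemma indep_rk I : indep M I = (rk M I == #|I|).
Proof.
apply/indepP/eqP => [[B BM sIB]|rkI].
  by apply/eqP; rewrite eqn_leq rk_card /= -{1}(setIidPl sIB) rk_ge.
have [B BM cB] := rk_attained I; exists B => //.
apply/setIidPl/eqP; rewrite eqEcard subsetIl /=.
by rewrite cB rkI.
Qed.

Lemma indep_basis I : indep M I -> #|I| = mrank M -> I \in bases M.
Proof.
move=> /indepP[B BM sIB] cI; suff -> : I = B by [].
by apply/eqP; rewrite eqEcard sIB cI (mrank_card BM) leqnn.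
Qed.

(** Among the bases containing [I], one that meets [B'] the most is inside
[I :|: B']: any further element could be exchanged for one of [B']. *)
Lemma basis_extension I B' : indep M I -> B' \in bases M ->
  exists2 B, B \in bases M & (I \subset B) && (B \subset I :|: B').
Proof.
move=> /indepP[B0 B0M sIB0] B'M.
pose P B := (B \in bases M) && (I \subset B).
have P0 : P B0 by rewrite /P B0M.
have [B /andP[BM sIB] maxB] := @arg_maxnP _ B0 P (fun B => #|B :&: B'|) P0.
exists B => //; rewrite sIB; apply/subsetP => z zB; rewrite inE; apply/negPn/negP.
rewrite negb_or => /andP[zI zB'].
have zD : z \in B :\: B' by rewrite inE zB'.
have [w /[!inE] /andP[wB wB'] wM] := bases_exchange BM B'M zD.
have := maxB (w |: (B :\ z)); rewrite /P wM /=.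
have -> : I \subset w |: B :\ z.
  apply/subsetP => u uI; rewrite !inE (subsetP sIB _ uI) andbT.
  by case: (u =P z) uI => [->|]; rewrite ?orbT // (negbTE zI).
move=> /(_ isT); apply/negP; rewrite -ltnNge; apply: proper_card.
apply/properP; split.
  apply/subsetP => u /setIP[uB uB']; rewrite !inE uB uB' !andbT.
  by case: (u =P z) uB' => [->|]; rewrite ?orbT // (negbTE zB').
by exists w; rewrite !inE ?eqxx ?wB' // (negbTE wB).
Qed.

(** Extending inside [I :|: B'], where [B'] is a basis meeting [A] in full rank,
adds no element outside [A] beyond those of [B'], hence as many inside. *)
Lemma indep_extension I A : indep M I -> I \subset A ->
  exists2 B, B \in bases M & (I \subset B) && (#|A :&: B| == rk M A).
Proof.
move=> iI sIA; have [B' B'M cB'] := rk_attained A.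
have [B BM /andP[sIB sB]] := basis_extension iI B'M.
exists B => //; rewrite sIB /= eqn_leq rk_ge //= -cB'.
have cBB := card_bases BM B'M.
have sD : B :\: A \subset B' :\: A.
  apply/subsetP => u; rewrite !inE => /andP[uA uB]; rewrite uA /=.
  have := subsetP sB _ uB; rewrite inE => /orP[/(subsetP sIA)|//].
  by rewrite (negbTE uA).
have := subset_leq_card sD; have := cardsID A B; have := cardsID A B'.
rewrite [A :&: B]setIC [A :&: B']setIC; lia.
Qed.

(** A single basis can be chosen to meet [A :&: C] and [A :|: C] both in full
rank, and then the two cardinalities add up. *)
Lemma rk_submod A C : rk M (A :|: C) + rk M (A :&: C) <= rk M A + rk M C.
Proof.
have [B' B'M cB'] := rk_attained (A :&: C).
have iI : indep M (A :&: C :&: B').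
  by apply/indepP; exists B' => //; apply: subsetIr.
have sI : A :&: C :&: B' \subset A :|: C.
  by apply/subsetP => u; rewrite !inE => /andP[/andP[->]].
have [B BM /andP[sIB /eqP cB]] := indep_extension iI sI.
rewrite -cB -cB'.
have le : #|A :&: C :&: B'| <= #|A :&: C :&: B|.
  by apply: subset_leq_card; rewrite subsetI sIB subsetIl.
have := rk_ge A BM; have := rk_ge C BM.
have := cardsUI (A :&: B) (C :&: B).
have -> : (A :&: B) :|: (C :&: B) = (A :|: C) :&: B by rewrite setIUl.
have -> : (A :&: B) :&: (C :&: B) = A :&: C :&: B.
  by apply/setP => u; rewrite !inE; do !case: (_ \in _).
lia.
Qed.

Lemma circuitP C : reflect
  [/\ C \subset ground M, ~~ indep M C & forall D, D \proper C -> indep M D]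
  (circuit M C).
Proof.
apply: (iffP minsetP) => [[/andP[sC dC] minC]|[sC dC minC]].
  split=> // D pDC; have [//|dD] := boolP (indep M D).
  have DC : D = C.
    by apply: minC (proper_sub pDC); apply/andP; split; first exact: subset_trans (proper_sub pDC) sC.
  by move: pDC; rewrite DC properxx.
split; first by rewrite sC.
move=> D /andP[sD dD] sDC; apply/eqP/negPn/negP => DC.
by case/negP: dD; apply: minC; rewrite properEneq DC.
Qed.

Lemma dep_circuit A : A \subset ground M -> ~~ indep M A ->
  exists2 C, circuit M C & C \subset A.
Proof.
move=> sA dA.
have [C minC sC] := @minset_exists _ (fun A => (A \subset ground M) && ~~ indep M A) A
  (introT andP (conj sA dA)).
by exists C.
Qed.

Lemma circuit_rk C : circuit M C -> rk M C < #|C|.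
Proof. by move=> /circuitP[_ dC _]; rewrite ltn_neqAle rk_card andbT -indep_rk. Qed.

Definition closure_in A : {set T} := [set x in ground M | rk M (x |: A) == rk M A].

Lemma cl_sub A : closure_in A \subset ground M.
Proof. by apply/subsetP => x /[!inE] /andP[]. Qed.

Lemma sub_cl A : A \subset ground M -> A \subset closure_in A.
Proof.
move=> sA; apply/subsetP => x xA; rewrite inE (subsetP sA) //=.
by rewrite setUC (setUidPl _) // sub1set.
Qed.

(** One element is adjoined at a time, with submodularity. *)
Lemma rk_clU A D : A \subset D -> D \subset closure_in A :|: A -> rk M D = rk M A.
Proof.
have [m] := ubnP #|D :\: A|; elim: m D => // m IHm D lt sAD sD.
have [/eqP|[x xD]] := set_0Vmem (D :\: A).
  by rewrite setD_eq0 => sDA; congr rk; apply/eqP; rewrite eqEsubset sDA.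
move: (xD); rewrite inE => /andP[xA xD'].
have sAD' : A \subset D :\ x.
  by apply/subsetP => u uA; rewrite !inE (subsetP sAD) // andbT; apply: contraNneq xA => <-.
have e : rk M (D :\ x) = rk M A.
  apply: IHm => //; last first.
    by apply: subset_trans sD; apply: subD1set.
  rewrite setDDl setUC -setDDl; move: lt; rewrite (cardsD1 x (D :\: A)) xD ltnS; lia.
have xcl : rk M (x |: A) = rk M A.
  have := subsetP sD _ xD'; rewrite !inE (negbTE xA) orbF => /andP[_ /eqP //].
have := rk_submod (D :\ x) (x |: A).
have -> : (D :\ x) :|: (x |: A) = D.
  apply/setP => u; rewrite !inE; case: (u =P x) => [->|_] /=; first by rewrite xD'.
  by case uA: (u \in A); rewrite ?orbF // (subsetP sAD).
have -> : (D :\ x) :&: (x |: A) = A.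
  apply/setP => u; rewrite !inE; case: (u =P x) => [->|_] /=; first by rewrite (negbTE xA).
  by case uA: (u \in A); rewrite ?andbF // (subsetP sAD).
by rewrite xcl e; have := rkS sAD; lia.
Qed.

Lemma rk_cl A : A \subset ground M -> rk M (closure_in A) = rk M A.
Proof. by move=> sA; apply: rk_clU; rewrite ?sub_cl ?subsetUl. Qed.

Lemma cl_flat A : A \subset ground M -> flat M (closure_in A).
Proof.
move=> sA; apply/andP; split; first exact: cl_sub.
apply/forallP => x; apply/implyP; rewrite inE => /andP[xcl xE].
rewrite rk_cl // ltnNge; apply: contra xcl => le.
rewrite inE xE /= eqn_leq [X in _ && X]rkS ?subsetUr // andbT.
by apply: leq_trans le; apply: rkS; apply: setUS; apply: sub_cl.
Qed.

Lemma flat_sub F : flat M F -> F \subset ground M.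
Proof. by case/andP. Qed.

Lemma flat_cl_sub F A : flat M F -> A \subset F -> closure_in A \subset F.
Proof.
move=> /andP[sF /forallP fF] sAF; apply/subsetP => x /[!inE] /andP[xE /eqP rkx].
apply/negPn/negP => xF; have := fF x; rewrite inE xF xE /=.
apply/negP; rewrite -leqNgt.
have := rk_submod (x |: A) F.
have -> : x |: A :|: F = x |: F by rewrite -setUA (setUidPr sAF).
have : rk M A <= rk M ((x |: A) :&: F).
  by apply: rkS; rewrite subsetI subsetUr.
lia.
Qed.

Lemma cyclicP A : reflect
  (forall x, x \in A -> exists2 C, circuit M C & (x \in C) && (C \subset A))
  (cyclic M A).
Proof.
apply: (iffP existsP) => [[S /andP[/forallP cS /eqP <-]] x|cA].
  move=> /bigcupP[C CS xC]; exists C; first by have := cS C; rewrite CS.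
  by rewrite xC; apply: bigcup_sup.
exists [set C | circuit M C & C \subset A]; apply/andP; split.
  by apply/forallP => C; apply/implyP; rewrite inE => /andP[].
rewrite eqEsubset; apply/andP; split.
  by apply/bigcupsP => C; rewrite inE => /andP[].
apply/subsetP => x /cA[C cC /andP[xC sC]]; apply/bigcupP; exists C => //.
by rewrite inE cC.
Qed.

(** The element is spanned by a maximal independent subset of [A]; the circuit
it closes with that subset has to contain it. *)
Lemma cl_circuit A x : A \subset ground M -> x \in closure_in A :\: A ->
  exists2 C, circuit M C & (x \in C) && (C \subset x |: A).
Proof.
move=> sA /[!inE] /andP[xA /andP[xE /eqP rkx]].
have [B BM cB] := rk_attained A.
have iI : indep M (A :&: B) by apply/indepP; exists B => //; apply: subsetIr.
have dI : ~~ indep M (x |: (A :&: B)).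
  rewrite indep_rk cardsU1 inE (negbTE xA) /= cB.
  have : rk M (x |: A :&: B) <= rk M (x |: A) by apply: rkS; apply: setUS; apply: subsetIl.
  by rewrite rkx; lia.
have sI : x |: (A :&: B) \subset ground M.
  by rewrite subUset sub1set xE; apply: subset_trans sA; apply: subsetIl.
have [C cC sC] := dep_circuit sI dI; exists C => //; apply/andP; split.
  apply/negPn/negP => xC; case/circuitP: cC => _ /negP[].
  apply: indepS iI; apply/subsetP => u uC; have := subsetP sC _ uC.
  by rewrite in_setU1 => /orP[/eqP ux|//]; rewrite ux (negbTE xC) in uC.
by apply: subset_trans sC _; apply: setUS; apply: subsetIl.
Qed.

Lemma cl_cyclic A : A \subset ground M -> cyclic M A -> cyclic M (closure_in A).
Proof.
move=> sA /cyclicP cA; apply/cyclicP => x xcl.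
have scl := sub_cl sA.
have [xA|xA] := boolP (x \in A).
  have [C cC /andP[xC sC]] := cA x xA; exists C => //.
  by rewrite xC (subset_trans sC).
have [|C cC /andP[xC sC]] := @cl_circuit A x sA; first by rewrite inE xA.
exists C => //; rewrite xC (subset_trans sC) //.
by rewrite subUset sub1set xcl.
Qed.

Lemma circuit_cyclic C : circuit M C -> cyclic M C.
Proof. by move=> cC; apply/cyclicP => x xC; exists C => //; rewrite xC subxx. Qed.

Lemma cyclicU A C : cyclic M A -> cyclic M C -> cyclic M (A :|: C).
Proof.
move=> /cyclicP cA /cyclicP cC; apply/cyclicP => x; rewrite inE.
case/orP => [/cA|/cC] [D cD /andP[xD sD]]; exists D => //; rewrite xD /=.
  by apply: subset_trans sD _; apply: subsetUl.
by apply: subset_trans sD _; apply: subsetUr.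
Qed.

End MatroidRank.

(** * Proper cyclic flats *)

Section ProperCyclicFlats.
Variables (T : finType) (M : matroid T).
Implicit Types (A B C D F G : {set T}) (x y : T).
Let E := ground M.
Let Z := proper_cyclic_flats M.
Let K := mrank M.

Lemma pcfP F : reflect [/\ flat M F, cyclic M F, F != set0 & F != E]
  (F \in Z).
Proof. by rewrite inE; apply: and4P. Qed.

Lemma pcf_sub F : F \in Z -> F \subset E.
Proof. by case/pcfP => /flat_sub. Qed.

Lemma pcf_rk_card F : F \in Z -> rk M F < #|F|.
Proof.
case/pcfP => _ /cyclicP cF /set0Pn[x /cF[C /circuitP[_ dC _] /andP[_ sC]]] _.
rewrite ltn_neqAle rk_card andbT -indep_rk; apply: contra dC; exact: indepS.
Qed.

Lemma pcf_rk_mrank F : F \in Z -> rk M F < K.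
Proof.
case/pcfP => /andP[sF /forallP fF] _ _ nE.
have : E :\: F != set0.
  by apply: contra nE; rewrite setD_eq0 => sE; rewrite eqEsubset sF.
case/set0Pn => x xD; have := fF x; rewrite xD => /leq_trans; apply.
exact: rk_mrank.
Qed.

Lemma cl_pcf A : A \subset E -> cyclic M A -> A != set0 -> closure_in M A != E -> closure_in M A \in Z.
Proof.
move=> sA cA /set0Pn[x xA] nE; apply/pcfP; split=> //.
- exact: cl_flat.
- exact: cl_cyclic.
by apply/set0Pn; exists x; apply: (subsetP (sub_cl sA)).
Qed.

(** A dependent set of size [K] contains a circuit, whose closure is a cyclic
flat on which the bound fails; this flat is not the ground set since a spanning
circuit has more than [K] elements. *)
Lemma basis_cyclic_flatP B : reflect
  [/\ B \subset E, #|B| = K & forall F, F \in Z -> #|B :&: F| <= rk M F]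
  (B \in bases M).
Proof.
apply: (iffP idP) => [BM|[sB cB bB]].
  split; [exact: bases_sub | by rewrite /K (mrank_card BM) |].
  by move=> F _; rewrite setIC; apply: rk_ge.
apply: indep_basis => //; have [//|dB] := boolP (indep M B).
have [C cC sCB] := dep_circuit sB dB; have rC := circuit_rk cC.
case/circuitP: (cC) => sC _ _.
have Cn0 : C != set0 by apply: contraTneq rC => ->; rewrite cards0.
have lt := subset_leq_card sCB.
have [clE|nE] := eqVneq (closure_in M C) E.
  have := rk_cl sC; rewrite clE -/(mrank M) -/K; lia.
have clZ : closure_in M C \in Z by apply: cl_pcf => //; apply: circuit_cyclic.
have := bB _ clZ; rewrite rk_cl // leqNgt => /negP[].
by apply: leq_trans rC _; apply: subset_leq_card; rewrite subsetI sCB sub_cl.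
Qed.

Section Connected.
Hypotheses (conM : connected M) (gt1 : 1 < #|ground M|).

Lemma connected_circuit x y : x \in E -> y \in E -> x != y ->
  exists2 C, circuit M C & (x \in C) && (y \in C).
Proof.
move=> xE yE xy; case/andP: conM => _ /forallP/(_ x)/implyP/(_ xE).
move=> /forallP/(_ y)/implyP/(_ yE)/implyP/(_ xy)/existsP[C /and3P[cC xC yC]].
by exists C => //; rewrite xC.
Qed.

Lemma circuit_through x : x \in E -> exists2 C, circuit M C & (x \in C) && (1 < #|C|).
Proof.
move=> xE; have : 0 < #|E :\ x| by have := cardsD1 x E; rewrite xE; move: gt1; rewrite -/E; lia.
case/card_gt0P => y /[!inE] /andP[yx yE].
have [|C cC /andP[xC yC]] := connected_circuit xE yE; first by rewrite eq_sym.
exists C => //; rewrite xC /=; apply/card_gt1P; exists x, y; split=> //.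
by rewrite eq_sym.
Qed.

Lemma rk_gt0 A : A \subset E -> A != set0 -> 0 < rk M A.
Proof.
move=> sA /set0Pn[x xA]; have [C /circuitP[_ _ cC] /andP[xC lt]] := circuit_through (subsetP sA _ xA).
have : indep M [set x].
  by apply: cC; rewrite properEcard sub1set xC cards1.
rewrite indep_rk cards1 => /eqP <-; apply: rkS; by rewrite sub1set.
Qed.

Lemma pcf_rk_gt0 F : F \in Z -> 0 < rk M F.
Proof. by move=> FZ; case/pcfP: (FZ) => _ _ ? _; apply: rk_gt0 => //; apply: pcf_sub. Qed.

Lemma circuit_avoid y : y \in E -> exists2 B, B \in bases M & y \notin B.
Proof.
move=> yE; have [C /circuitP[_ dC cC] /andP[yC _]] := circuit_through yE.
have : indep M (C :\ y) by apply: cC; apply: properD1.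
case/indepP => B BM sB; exists B => //; apply: contra dC => yB.
apply/indepP; exists B => //; apply/subsetP => u uC.
by case: (u =P y) => [->//|/eqP uy]; apply: (subsetP sB); rewrite !inE uy.
Qed.

(** Otherwise every basis would contain the whole complement of [F], whose
elements would be coloops. *)
Lemma pcf_corank F : F \in Z -> K - rk M F < #|E :\: F|.
Proof.
move=> FZ; case/pcfP: (FZ) => _ _ _ nE.
have : E :\: F != set0.
  by apply: contra nE; rewrite setD_eq0 => sE; rewrite eqEsubset pcf_sub.
case/set0Pn => y /[dup] yD /setDP[yE yF].
have [B BM yB] := circuit_avoid yE.
have := rk_ge F BM; have := mrank_card BM; have := cardsID F B.
have : #|B :\: F| < #|E :\: F|.
  apply: proper_card; apply/properP; split; first exact/setSD/bases_sub.
  by exists y => //; rewrite inE (negbTE yB) andbF.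
by rewrite setIC /K; clear; lia.
Qed.

(** If the ranks added up to [K], rank would be additive over the partition, and
a circuit meeting both parts, being the union of two independent proper subsets,
would be independent. *)
Lemma rk_complement F G : F \subset E -> F != set0 -> G \subset E -> G != set0 ->
  F :&: G = set0 -> F :|: G = E -> K < rk M F + rk M G.
Proof.
move=> sF /set0Pn[x xF] sG /set0Pn[y yG] FG0 FGE; rewrite ltnNge; apply/negP => le.
have xy : x != y.
  by apply: contraTneq xF => ->; apply: contraT => /negPn yF; have := in_set0 y; rewrite -FG0 inE yF yG.
have [C /circuitP[sC dC cC] /andP[xC yC]] := connected_circuit (subsetP sF _ xF) (subsetP sG _ yG) xy.
have xG : x \notin G by apply: contraT => /negPn xG; have := in_set0 x; rewrite -FG0 inE xF xG.
have yF : y \notin F by apply: contraT => /negPn yF; have := in_set0 y; rewrite -FG0 inE yF yG.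
have iF : indep M (C :&: F).
  by apply: cC; apply/properP; split; [apply: subsetIl|exists y; rewrite // inE (negbTE yF) andbF].
have iG : indep M (C :&: G).
  by apply: cC; apply/properP; split; [apply: subsetIl|exists x; rewrite // inE (negbTE xG) andbF].
move: dC; rewrite indep_rk; move: iF iG; rewrite !indep_rk => /eqP iF /eqP iG.
have cFG : #|C :&: F| + #|C :&: G| = #|C|.
  rewrite -cardsUI -setIUr FGE (setIidPl sC) -setIA [F :&: (C :&: G)]setICA FG0 setI0 setI0 cards0.
  by rewrite addn0.
have h1 := rk_submod M C F; have h2 := rk_submod M (C :|: F) G.
have e1 : C :|: F :|: G = E by rewrite -setUA FGE (setUidPr sC).
have e2 : (C :|: F) :&: G = C :&: G by rewrite setIUl FG0 setU0.
rewrite e1 e2 iG -/(mrank M) -/K in h2; rewrite iF in h1.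
apply/eqP; move: (rk_card M C) h1 h2 le; rewrite -cFG; clear; lia.
Qed.

Lemma pcf_strict_pair F G : F \in Z -> G \in Z ->
  F :&: G = set0 -> F :|: G = E -> K < rk M F + rk M G.
Proof.
move=> FZ GZ; case/pcfP: (FZ) => _ _ Fn _; case/pcfP: (GZ) => _ _ Gn _.
by apply: rk_complement => //; apply: pcf_sub.
Qed.

End Connected.

Section ElementarySplit.
Hypothesis splM : elementary_split M.

Lemma pcf_eq F G : F \in Z -> G \in Z -> F \subset G -> F = G.
Proof.
move=> FZ GZ; move/forallP/(_ F): splM; rewrite FZ => /forallP/(_ G); rewrite GZ /=.
by move=> /implyP s /s /eqP.
Qed.

(** This is submodularity with the two extreme ranks known: a circuit inside
[F :&: G] would span a proper cyclic flat inside both flats, and a non-spanning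
[F :|: G] would lie in a proper cyclic flat containing both. *)
Lemma pcf_pair F G : F \in Z -> G \in Z -> F != G ->
  #|F :&: G| + K <= rk M F + rk M G.
Proof.
move=> FZ GZ nFG; have sF := pcf_sub FZ; have sG := pcf_sub GZ.
case/pcfP: (FZ) => fF cF Fn0 FE; case/pcfP: (GZ) => fG cG _ _.
have sU : F :|: G \subset E by rewrite subUset sF.
have <- : rk M (F :&: G) = #|F :&: G|.
  apply/eqP; rewrite -indep_rk; have [//|dI] := boolP (indep M (F :&: G)).
  have [|C cC] := dep_circuit _ dI; first by rewrite subIset ?sF.
  rewrite subsetI => /andP[sCF sCG]; case/circuitP: (cC) => sC dC _.
  have clF := flat_cl_sub fF sCF; have clG := flat_cl_sub fG sCG.
  have clZ : closure_in M C \in Z.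
    apply: cl_pcf => //.
    - exact: circuit_cyclic.
    - by apply: contraNneq dC => ->; have [B BM] := bases_neq0 M; apply/indepP; exists B; rewrite ?sub0set.
    - by apply: contraNneq FE => e; rewrite eqEsubset sF -e.
  by move: nFG; rewrite -(pcf_eq clZ FZ clF) -(pcf_eq clZ GZ clG) eqxx.
have <- : rk M (F :|: G) = K.
  rewrite -rk_cl // /K /mrank; congr rk; apply/eqP/negPn/negP => nE.
  have sFc : F :|: G \subset closure_in M (F :|: G) by apply: sub_cl.
  have clZ : closure_in M (F :|: G) \in Z.
    apply: cl_pcf => //; first exact: cyclicU.
    by have /set0Pn[x xF] := Fn0; apply/set0Pn; exists x; rewrite inE xF.
  move: nFG; rewrite (pcf_eq FZ clZ) ?(subset_trans _ sFc) ?subsetUl //.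
  by rewrite -(pcf_eq GZ clZ) ?eqxx // (subset_trans _ sFc) ?subsetUr.
by rewrite addnC; apply: rk_submod.
Qed.

End ElementarySplit.

End ProperCyclicFlats.
(** * Set families bounded on a system of cuts *)

Section Families.
Variable (T : finType).
Implicit Types (A B C F G : {set T}) (BB : {set {set T}}) (x y : T).

(** Every matroid has this stronger exchange property.  Unlike plain exchange, it
passes to the subfamily of maximal weight, since both swapped sets remain in the
family and their weights have the same sum as before. *)
Definition symmetric_exchange BB := forall B1 B2 x, B1 \in BB -> B2 \in BB ->
  x \in B1 :\: B2 -> exists2 y, y \in B2 :\: B1 &
    (y |: (B1 :\ x) \in BB) && (x |: (B2 :\ y) \in BB).

Lemma matroid_of_family (E : {set T}) BB : symmetric_exchange BB ->
  {in BB, forall B, B \subset E} -> BB != set0 ->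
  exists M : matroid T, ground M = E /\ bases M = BB.
Proof.
move=> ex sub /set0Pn ne.
have ex' B1 B2 x : B1 \in BB -> B2 \in BB -> x \in B1 :\: B2 ->
    exists2 y, y \in B2 :\: B1 & y |: (B1 :\ x) \in BB.
  by move=> B1B B2B /(ex _ _ _ B1B B2B)[y yD /andP[]]; exists y.
by exists (Matroid sub ne ex').
Qed.

Lemma card_swap_in B F x y : x \in B -> y \notin B -> x \notin F -> y \in F ->
  #|(y |: (B :\ x)) :&: F| = #|B :&: F|.+1.
Proof.
move=> xB yB xF yF; have -> : (y |: B :\ x) :&: F = y |: (B :&: F).
  apply/setP => u; rewrite !inE; case: (u =P y) => [->|_] /=; first by rewrite yF.
  by case: (u =P x) => [->|_] //=; rewrite (negbTE xF) andbF.
by rewrite cardsU1 inE (negbTE yB).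
Qed.

Lemma card_swap_le B F x y : (x \in F) || (y \notin F) ->
  x \in B -> #|(y |: (B :\ x)) :&: F| <= #|B :&: F|.
Proof.
move=> xyF xB; have [yF|yF] := boolP (y \in F); last first.
  apply: subset_leq_card; apply/subsetP => u; rewrite !inE.
  by case/andP => /orP[/eqP ->|/andP[_ ->]//]; rewrite (negbTE yF).
have xF : x \in F by move: xyF; rewrite yF orbF.
rewrite (cardsD1 x (B :&: F)) inE xB xF /=.
have s : (y |: B :\ x) :&: F \subset y |: ((B :&: F) :\ x).
  by apply/subsetP => u; rewrite !inE; case: (u == y) => //=; case: (u == x).
by apply: leq_trans (subset_leq_card s) _; rewrite cardsU1; case: (_ \in _).
Qed.

Variables (E : {set T}) (K : nat).
Implicit Types (S : {set {set T}}) (b : {set T} -> nat).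

Definition cut_bases (S : {set {set T}}) (b : {set T} -> nat) : {set {set T}} :=
  [set B : {set T} | [&& B \subset E, #|B| == K & [forall F in S, #|B :&: F| <= b F]]].

(** The inequality prevents two hyperplanes x(F) = b F and x(G) = b G from
crossing inside the hypersimplex, as x(F) + x(G) <= K + #|F :&: G| there. *)
Definition compatible_cuts (S : {set {set T}}) (b : {set T} -> nat) :=
  {in S, forall F, F \subset E} /\
  {in S &, forall F G, F != G -> #|F :&: G| + K <= b F + b G}.

Lemma cut_basesP S b B : reflect
  [/\ B \subset E, #|B| = K & {in S, forall F, #|B :&: F| <= b F}] (B \in cut_bases S b).
Proof.
rewrite inE; apply: (iffP and3P) => [[? /eqP ? /forallP h]|[? ? h]]; split=> //.
- by move=> F FS; have := h F; rewrite FS.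
- exact/eqP.
- by apply/forallP => F; apply/implyP/h.
Qed.

(** Both inequalities that bound #|B :&: F| + #|B :&: G| by b F + b G are then
equalities. *)
Lemma tight_pair S b B F G : compatible_cuts S b -> B \in cut_bases S b ->
  F \in S -> G \in S -> F != G -> #|B :&: F| = b F -> #|B :&: G| = b G ->
  F :&: G \subset B /\ B \subset F :|: G.
Proof.
move=> [_ comp] /cut_basesP[sB cB _] FS GS nFG tF tG.
have := comp _ _ FS GS nFG; rewrite -tF -tG -cardsUI -setIUr -setIIr.
have := subset_leq_card (subsetIl B (F :|: G)).
have := subset_leq_card (subsetIr B (F :&: G)).
move=> h1 h2 h3; split.
  apply/setIidPr/eqP; rewrite eqEcard subsetIr; lia.
by apply/setIidPl/eqP; rewrite eqEcard subsetIl; lia.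
Qed.

(** Exchanging [x] for [y] can only break cuts that are tight on [B1], avoid [x]
and contain [y], or that are tight on [B2], contain [x] and avoid [y].  By
[tight_pair] there is at most one cut of each kind to worry about, and a count
shows that [B2] still offers a suitable [y]. *)
Lemma cut_symmetric_exchange S b : compatible_cuts S b -> symmetric_exchange (cut_bases S b).
Proof.
move=> comp B1 B2 x B1M B2M /setDP[xB1 xB2].
have [sB1 cB1 bB1] := cut_basesP _ _ _ B1M; have [sB2 cB2 bB2] := cut_basesP _ _ _ B2M.
pose bad1 F := [&& F \in S, x \notin F & #|B1 :&: F| == b F].
pose bad2 G := [&& G \in S, x \in G & #|B2 :&: G| == b G].
suff [y yB2 [yB1 y1 y2]] : exists2 y, y \in B2 & [/\ y \notin B1,
    forall F, bad1 F -> y \notin F & forall G, bad2 G -> y \in G].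
  exists y; first by rewrite inE yB1.
  apply/andP; split; apply/cut_basesP; split.
  - rewrite subUset sub1set (subsetP sB2) //=; apply: subset_trans sB1; apply: subD1set.
  - by rewrite card_exchange.
  - move=> F FS; have [xyF|] := boolP ((x \in F) || (y \notin F)).
      by apply: leq_trans (bB1 _ FS); apply: card_swap_le.
    rewrite negb_or negbK => /andP[xF yF]; rewrite card_swap_in //.
    rewrite ltn_neqAle bB1 // andbT; apply: contraL yF => tF.
    by apply: y1; rewrite /bad1 FS xF.
  - rewrite subUset sub1set (subsetP sB1) //=; apply: subset_trans sB2; apply: subD1set.
  - by rewrite card_exchange.
  - move=> G GS; have [xyG|] := boolP ((y \in G) || (x \notin G)).
      by apply: leq_trans (bB2 _ GS); apply: card_swap_le.
    rewrite negb_or negbK => /andP[yG xG]; rewrite card_swap_in //.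
    rewrite ltn_neqAle bB2 // andbT; apply: contra yG => tG.
    by apply: y2; rewrite /bad2 GS xG.
have bad1_uniq F F' : bad1 F -> bad1 F' -> F = F'.
  move=> /and3P[FS xF /eqP tF] /and3P[FS' xF' /eqP tF']; apply/eqP/negPn/negP => n.
  have [_ /subsetP/(_ x xB1)] := tight_pair comp B1M FS FS' n tF tF'.
  by rewrite inE (negbTE xF) (negbTE xF').
have bad2_uniq F F' : bad2 F -> bad2 F' -> F = F'.
  move=> /and3P[FS xF /eqP tF] /and3P[FS' xF' /eqP tF']; apply/eqP/negPn/negP => n.
  have [/subsetP/(_ x)] := tight_pair comp B2M FS FS' n tF tF'.
  by rewrite inE xF xF' (negbTE xB2) => /(_ isT).
(* F and G stand for the tight cuts of the two kinds; when there is none, the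
   empty set and the full set impose no condition *)
have sub_eq (F G : {set T}) : (forall H, bad1 H -> H = F) -> (forall H, bad2 H -> H = G) ->
   ~~ (B2 :&: G \subset B1 :|: F) -> exists2 y, y \in B2 & [/\ y \notin B1,
    forall F, bad1 F -> y \notin F & forall G, bad2 G -> y \in G].
  move=> eF eG /subsetPn[y /setIP[yB2 yG]]; rewrite inE negb_or => /andP[yB1 yF].
  by exists y => //; split=> // H => [/eF|/eG] ->.
have [F badF|noF] := pickP bad1; have [G badG|noG] := pickP bad2.
- apply: (sub_eq F G) => [H /bad1_uniq/(_ badF)//|H /bad2_uniq/(_ badG)//|]; apply/negP => sub.
  case/and3P: badF => FS xF /eqP tF; case/and3P: badG => GS xG /eqP tG.
  have nFG : F != G by apply: contraNneq xF => ->.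
  case: comp => _ /(_ _ _ FS GS nFG); rewrite -tF -tG -cB1.
  have s : B2 :&: G \subset (F :&: G) :|: ((B1 :\: F) :\ x).
    apply/subsetP => u uBG; have := subsetP sub _ uBG.
    move: uBG; rewrite !inE; case: (u =P x) => [->|_]; first by rewrite (negbTE xB2).
    by case/andP=> _ ->; case: (u \in F) => //=; rewrite orbF.
  have := leq_trans (subset_leq_card s) (leq_card_setU _ _).1.
  have := cardsD1 x (B1 :\: F); rewrite inE xB1 xF /= -(cardsID F B1); clear; lia.
- apply: (sub_eq F [set: T]) => [H /bad1_uniq/(_ badF)//|H|]; first by rewrite noG.
  rewrite setIT; apply/negP => sub.
  case/and3P: badF => FS xF /eqP tF.
  have := bB2 F FS; rewrite -tF.
  have s : B2 :\: F \subset (B1 :\: F) :\ x.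
    apply/subsetP => u; rewrite !inE => /andP[uF uB2]; rewrite uF.
    have := subsetP sub _ uB2; rewrite inE (negbTE uF) orbF => ->.
    by rewrite !andbT; apply: contraNneq xB2 => <-.
  have := subset_leq_card s; have := cardsD1 x (B1 :\: F); rewrite inE xB1 xF /=.
  by move: (cardsID F B1) (cardsID F B2) cB1 cB2; clear; lia.
- apply: (sub_eq set0 G) => [H|H /bad2_uniq/(_ badG)//|]; first by rewrite noF.
  rewrite setU0; apply/negP => sub.
  case/and3P: badG => GS xG /eqP tG.
  have := bB1 G GS; rewrite -tG leqNgt => /negP[].
  apply: proper_card; apply/properP; split; first by rewrite subsetI sub subsetIr.
  by exists x; rewrite ?inE ?xB1 ?xG // (negbTE xB2).
apply: (sub_eq set0 [set: T]) => [H|H|]; rewrite ?noF ?noG //.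
rewrite setIT setU0; apply/negP => s.
have := subset_cardP (etrans cB2 (esym cB1)) s.
by move=> /(_ x); rewrite xB1 (negbTE xB2).
Qed.

Lemma cut_bases_sub S b : {in cut_bases S b, forall B, B \subset E}.
Proof. by move=> B /cut_basesP[]. Qed.

End Families.
(** * Polytopes spanned by set families, and their faces *)

Local Open Scope ring_scope.

Section Hulls.
Variables (R : realType) (T : finType).
Implicit Types (A B : {set T}) (BB CC : {set {set T}}) (x y z w c : T -> R).

Definition dot w x : R := \sum_t w t * x t.

Definition hull BB : classical_sets.set (T -> R) :=
  convex_hull (fun x => exists2 B, B \in BB & x = indicator R B).

(** Coefficients indexed by the sets themselves, so that combinations of the same
family can be compared term by term. *)
Lemma hullP BB x : hull BB x <-> exists c : {set T} -> R,
  [/\ forall B, 0 <= c B, forall B, B \notin BB -> c B = 0, \sum_B c B = 1 &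
      forall t, x t = \sum_B c B * indicator R B t].
Proof.
split=> [[m [c [u [uB c0 c1 xE]]]]|[c [c0 cB c1 xE]]].
  have /choice[f fP] : forall i, exists B, B \in BB /\ u i = indicator R B.
    by move=> i; have [B BBB uE] := uB i; exists B.
  exists (fun B => \sum_(i | f i == B) c i); split.
  - by move=> B; apply: sumr_ge0.
  - move=> B nB; apply: big1 => i /eqP fi; have [] := fP i.
    by rewrite fi (negbTE nB).
  - by rewrite -c1; symmetry; apply: partition_big.
  move=> t; rewrite xE /lincomb (partition_big f xpredT) //=.
  apply: eq_bigr => B _; rewrite mulr_suml; apply: eq_bigr => i /eqP fi.
  by have [_ ->] := fP i; rewrite fi.
exists #|BB|, (fun i => c (enum_val i)), (fun i => indicator R (enum_val i)).
have red (h : {set T} -> R) : (forall B, B \notin BB -> h B = 0) ->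
    \sum_B h B = \sum_(i < #|BB|) h (enum_val i).
  move=> h0; rewrite -(big_enum_val (A := mem BB) h) /= [LHS](bigID [in BB]) /=.
  by rewrite [X in _ + X]big1 ?addr0 // => B /h0.
split=> //.
- by move=> i; exists (enum_val i) => //; apply: enum_valP.
- by rewrite -(red c).
apply/funext => t; rewrite xE /lincomb -(red (fun B => c B * indicator R B t)) // => B /cB ->.
exact: mul0r.
Qed.

Lemma hull_indicator BB B : B \in BB -> hull BB (indicator R B).
Proof.
move=> BBB; apply/hullP; exists (fun C => (C == B)%:R); split.
- by move=> C; apply: ler0n.
- by move=> C; case: eqP => // ->; rewrite BBB.
- by rewrite (bigD1 B) //= eqxx big1 ?addr0 // => C /negbTE ->.
- move=> t; rewrite (bigD1 B) //= eqxx mul1r big1 ?addr0 // => C /negbTE ->.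
  exact: mul0r.
Qed.

Lemma hullS BB CC x : BB \subset CC -> hull BB x -> hull CC x.
Proof.
move=> s /hullP[c [c0 cB c1 xE]]; apply/hullP; exists c; split=> // B nB.
by apply: cB; apply: contra nB; apply: (subsetP s).
Qed.

Definition mix (s : R) x y : T -> R := fun t => s * x t + (1 - s) * y t.

Lemma hull_mix BB x y s : 0 <= s -> s <= 1 -> hull BB x -> hull BB y -> hull BB (mix s x y).
Proof.
move=> s0 s1 /hullP[c [c0 cB c1 xE]] /hullP[d [d0 dB d1 yE]]; apply/hullP.
exists (fun B => s * c B + (1 - s) * d B); split.
- by move=> B; rewrite addr_ge0 // mulr_ge0 // subr_ge0.
- by move=> B nB; rewrite cB // dB // !mulr0 addr0.
- by rewrite big_split /= -!mulr_sumr c1 d1 !mulr1 addrC subrK.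
move=> t; rewrite /mix xE yE !mulr_sumr -big_split /=; apply: eq_bigr => B _; ring.
Qed.

Lemma dot_mix w x y s : dot w (mix s x y) = s * dot w x + (1 - s) * dot w y.
Proof.
rewrite /dot !mulr_sumr -big_split /=; apply: eq_bigr => t _; rewrite /mix; ring.
Qed.

Lemma dotDl w c x : dot (fun t => w t + c t) x = dot w x + dot c x.
Proof. by rewrite /dot -big_split /=; apply: eq_bigr => t _; rewrite mulrDl. Qed.

Lemma dotZl w s x : dot (fun t => s * w t) x = s * dot w x.
Proof. by rewrite /dot mulr_sumr; apply: eq_bigr => t _; rewrite mulrA. Qed.

Lemma dotNl w x : dot (fun t => - w t) x = - dot w x.
Proof. by rewrite /dot -sumrN; apply: eq_bigr => t _; rewrite mulNr. Qed.

Lemma dot_move w x y s : dot w (fun t => x t + s * y t) = dot w x + s * dot w y.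
Proof.
rewrite /dot mulr_sumr -big_split /=; apply: eq_bigr => t _; ring.
Qed.

Definition weight w B : R := dot w (indicator R B).

Lemma hull_dot BB x w (c : {set T} -> R) :
  (forall t, x t = \sum_B c B * indicator R B t) -> dot w x = \sum_B c B * weight w B.
Proof.
move=> xE; rewrite /dot; under eq_bigr do rewrite xE mulr_sumr.
rewrite exchange_big /=; apply: eq_bigr => B _; rewrite /weight /dot mulr_sumr.
by apply: eq_bigr => t _; ring.
Qed.

Lemma hull_dot_le BB x w a : hull BB x -> (forall B, B \in BB -> weight w B <= a) ->
  dot w x <= a.
Proof.
move=> /hullP[c [c0 cB c1 xE]] le; rewrite (hull_dot BB w xE) -[leRHS]mul1r -c1 mulr_suml.
apply: ler_sum => B _; have [BBB|nB] := boolP (B \in BB); first by rewrite ler_wpM2l ?le.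
by rewrite cB // !mul0r.
Qed.

Lemma hull_dot_eq BB x w a : hull BB x -> (forall B, B \in BB -> weight w B = a) -> dot w x = a.
Proof.
move=> hx eq; apply/eqP; rewrite eq_le; apply/andP; split.
  by apply: hull_dot_le hx _ => B /eq ->.
rewrite -lerN2 -dotNl; apply: hull_dot_le hx _ => B BB'.
by rewrite /weight dotNl -/(weight w B) eq.
Qed.

(** In a convex combination attaining an upper bound, every set of smaller weight
has coefficient zero. *)
Lemma hull_dot_max BB x w a : hull BB x -> (forall B, B \in BB -> weight w B <= a) ->
  dot w x = a -> hull [set B in BB | weight w B == a] x.
Proof.
move=> /hullP[c [c0 cB c1 xE]] le; rewrite (hull_dot BB w xE) => eq.
apply/hullP; exists c; split=> // B; rewrite inE negb_and.
case/orP => [/cB //|nw]; have [BBB|/cB//] := boolP (B \in BB).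
have ge C : 0 <= c C * (a - weight w C).
  have [CB|/cB ->] := boolP (C \in BB); last by rewrite mul0r.
  by rewrite mulr_ge0 // subr_ge0 le.
have : \sum_C c C * (a - weight w C) = 0.
  under eq_bigr do rewrite mulrBr.
  by rewrite sumrB eq -mulr_suml c1 mul1r subrr.
move/eqP; rewrite psumr_eq0 // => /allP/(_ B); rewrite mem_index_enum => /(_ isT).
by rewrite /= mulf_eq0 subr_eq0 [a == _]eq_sym (negbTE nw) orbF => /eqP.
Qed.

Lemma hull_neq0 BB x : hull BB x -> exists B, B \in BB.
Proof.
move=> /hullP[c [c0 cB c1 _]]; apply/set0Pn; apply: contraT => /negPn/eqP BB0.
move: c1; rewrite big1 => [/esym/eqP|B _]; first by rewrite oner_eq0.
by apply: cB; rewrite BB0 inE.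
Qed.

(** The vertices of the face of the hull on which the functional [w] is maximal. *)
Definition heaviest BB w : {set {set T}} :=
  [set B in BB | [forall C in BB, weight w C <= weight w B]].

Lemma heaviestP BB w B : reflect
  (B \in BB /\ forall C, C \in BB -> weight w C <= weight w B) (B \in heaviest BB w).
Proof.
rewrite inE; apply: (iffP andP) => [[-> /forallP h]|[-> h]]; split=> //.
  by move=> C CB; have := h C; rewrite CB.
by apply/forallP => C; apply/implyP/h.
Qed.

Lemma heaviest_sub BB w : heaviest BB w \subset BB.
Proof. by apply/subsetP => B /heaviestP[]. Qed.

Lemma heaviest_exists BB w : BB != set0 -> exists B, B \in heaviest BB w.
Proof.
case/set0Pn => B0 B0B; exists [arg max_(B > B0 in BB) weight w B]%O.
by case: arg_maxP => // B BBB max; apply/heaviestP; split.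
Qed.

Lemma heaviestE BB w B0 : B0 \in heaviest BB w ->
  heaviest BB w = [set B in BB | weight w B == weight w B0].
Proof.
move=> /heaviestP[B0B max]; apply/setP => B; apply/heaviestP/idP => [[BBB maxB]|].
  by rewrite inE BBB eq_le max // maxB.
by rewrite inE => /andP[BBB /eqP eB]; split=> // C /max; rewrite eB.
Qed.

Lemma heaviest0 BB : heaviest BB (fun=> 0) = BB.
Proof.
apply/setP => B; apply/heaviestP/idP => [[]//|BBB]; split=> // C _.
by rewrite /weight /dot !big1 // => t _; rewrite mul0r.
Qed.

Lemma hull_heaviest BB w B0 x : B0 \in heaviest BB w ->
  (hull (heaviest BB w) x <-> hull BB x /\ dot w x = weight w B0).
Proof.
move=> B0h; split=> [hx|[hx eq]]; last first.
  rewrite (heaviestE B0h); apply: hull_dot_max => //.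
  by case/heaviestP: B0h.
split; first exact: hullS (heaviest_sub _ _) hx.
apply: hull_dot_eq hx _ => B; rewrite (heaviestE B0h) inE => /andP[_ /eqP //].
Qed.

Lemma face_hull BB F : BB != set0 -> (face (hull BB) F <-> exists w, F = hull (heaviest BB w)).
Proof.
move=> ne; have eqv w : (fun x => hull BB x /\ forall y, hull BB y ->
    \sum_t w t * y t <= \sum_t w t * x t) = hull (heaviest BB w).
  have [B0 B0h] := heaviest_exists w ne; have [B0B max] := heaviestP _ _ _ B0h.
  apply/funext => x; apply/propext; split=> [[hx mx]|/(hull_heaviest _ B0h)[hx eq]].
    apply/(hull_heaviest _ B0h); split=> //; apply/eqP; rewrite eq_le.
    by rewrite (hull_dot_le hx max) (mx _ (hull_indicator B0B)).
  by split=> // y hy; rewrite [leRHS]eq; apply: hull_dot_le hy max.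
by split=> -[w ->]; exists w; rewrite eqv.
Qed.

Lemma heaviest_restrict BB CC w : CC \subset BB -> heaviest BB w :&: CC != set0 ->
  heaviest BB w :&: CC = heaviest CC w.
Proof.
move=> s /set0Pn[B0 /setIP[/heaviestP[B0B max0] B0C]]; apply/setP => B; rewrite inE.
apply/andP/idP => [[/heaviestP[BBB max] BC]|/heaviestP[BC max]].
  by apply/heaviestP; split=> // C CC'; apply/max/(subsetP s).
split=> //; apply/heaviestP; split=> [|C CB]; first exact: (subsetP s).
exact: le_trans (max0 _ CB) (max _ B0C).
Qed.

End Hulls.

Section PositiveBound.
Variables (R : realType) (I : finType).

Lemma positive_lower_bound (Q : pred I) (f : I -> R) : (forall i, Q i -> 0 < f i) ->
  exists2 d : R, 0 < d & forall i, Q i -> d <= f i.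
Proof.
move=> f0; have [i0 Qi0|no] := pickP Q; last by exists 1 => // i; rewrite no.
by exists (f [arg min_(i < i0 | Q i) f i]%O); case: arg_minP => // i Qi min; apply: f0.
Qed.

End PositiveBound.

Section HeaviestHeaviest.
Variables (R : realType) (T : finType).
Implicit Types (BB : {set {set T}}) (w c : T -> R).

(** A face of a face is a face: perturb the first functional by a multiple of the
second, small enough not to overturn any strict inequality of the first. *)
Lemma heaviest_heaviest BB w c : exists w', heaviest (heaviest BB w) c = heaviest BB w'.
Proof.
have [->|ne] := eqVneq BB set0.
  by exists w; apply/setP => B; apply/heaviestP/heaviestP => -[]; rewrite ?inE // => /andP[]; rewrite inE.
have [B0 B0h] := heaviest_exists w ne; have [B0B max0] := heaviestP _ _ _ B0h.
pose Q := [pred B in BB | B \notin heaviest BB w].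
have [|d d0 dP] := @positive_lower_bound R _ Q (fun B => weight w B0 - weight w B).
  move=> B /= /andP[BBB]; rewrite (heaviestE B0h) inE BBB /= => nw.
  by rewrite subr_gt0 lt_neqAle nw max0.
pose D := \sum_B `|weight c B|.
have Dle B : `|weight c B| <= D by rewrite /D (bigD1 B) //= lerDl sumr_ge0.
have D0 : 0 <= D by apply: sumr_ge0.
pose e := d / (2 * D + 1).
have e0 : 0 < e by rewrite divr_gt0 // ltr_wpDl // mulr_ge0.
have eD : e * (2 * D) < d.
  by rewrite /e mulrAC ltr_pdivrMr ?ltr_wpDl ?mulr_ge0 // ltr_pM2l // ltrDl.
have wE B : weight (fun t => w t + e * c t) B = weight w B + e * weight c B.
  by rewrite /weight dotDl dotZl.
have gap B C : B \in heaviest BB w -> C \in BB -> C \notin heaviest BB w ->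
    weight (fun t => w t + e * c t) C < weight (fun t => w t + e * c t) B.
  move=> Bh CB nC; rewrite !wE.
  have := dP C; rewrite /= CB nC => /(_ isT).
  have -> : weight w B0 = weight w B.
    by move: Bh; rewrite (heaviestE B0h) inE => /andP[_ /eqP].
  move=> le; have : e * (weight c C - weight c B) <= e * (2 * D).
    rewrite ler_pM2l //; have := Dle C; have := Dle B.
    rewrite !ler_norml => /andP[? ?] /andP[? ?]; lra.
  lra.
exists (fun t => w t + e * c t); apply/setP => B.
apply/heaviestP/heaviestP => [[Bh max]|[BBB max]].
  split=> [|C CB]; first exact: (subsetP (heaviest_sub _ _)) Bh.
  have [Ch|nC] := boolP (C \in heaviest BB w); last exact/ltW/gap.
  rewrite !wE; move: (Bh) (Ch); rewrite (heaviestE B0h) !inE.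
  move=> /andP[_ /eqP ->] /andP[_ /eqP ->].
  by rewrite lerD2l ler_pM2l // max.
have Bh : B \in heaviest BB w.
  apply: contraT => nB; have := gap _ _ B0h BBB nB.
  by rewrite ltNge max.
split=> // C Ch; have := max C (subsetP (heaviest_sub _ _) _ Ch); rewrite !wE.
move: (Bh) (Ch); rewrite (heaviestE B0h) !inE => /andP[_ /eqP ->] /andP[_ /eqP ->].
by rewrite lerD2l ler_pM2l.
Qed.

End HeaviestHeaviest.
(** * Polytopes cut by a hyperplane *)

Section Splitting.
Variables (R : realType) (T : finType).
Implicit Types (B : {set T}) (BB CC S : {set {set T}}) (l c w x y z : T -> R) (a : R).

Lemma weightE w B : weight w B = \sum_(t in B) w t.
Proof.
rewrite /weight /dot [RHS]big_mkcond; apply: eq_bigr => t _; rewrite /indicator.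
by case: (t \in B); rewrite ?mulr1 ?mulr0.
Qed.

Lemma weight_swap w B s t : s \in B -> t \notin B ->
  weight w (t |: (B :\ s)) = weight w B - w s + w t.
Proof.
move=> sB tB; rewrite !weightE big_setU1 /=; last by rewrite !inE (negbTE tB) andbF.
by rewrite [in RHS](big_setD1 s) //=; ring.
Qed.

Lemma heaviest_symmetric_exchange BB w : symmetric_exchange BB ->
  symmetric_exchange (heaviest BB w).
Proof.
move=> ex B1 B2 s /heaviestP[B1B max1] /heaviestP[B2B max2] sD.
have [t tD /andP[B1' B2']] := ex _ _ _ B1B B2B sD.
exists t => //; have [sB1 sB2] := setDP sD; have [tB2 tB1] := setDP tD.
have e : weight w B1 = weight w B2 by apply/eqP; rewrite eq_le max1 ?max2.
have := max1 _ B1'; have := max2 _ B2'; rewrite !weight_swap // => h2 h1.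
apply/andP; split; apply/heaviestP; split=> // C CB; rewrite weight_swap //.
  by have := max1 _ CB; lra.
by have := max2 _ CB; lra.
Qed.

(** The 0/1 points of the hull are exactly the indicators of its generating sets:
each of them is the unique maximum of some functional over the cube. *)
Lemma hull_inj : injective (@hull R T).
Proof.
suff sub BB CC : hull BB = @hull R T CC -> BB \subset CC.
  by move=> BB CC e; apply/eqP; rewrite eqEsubset !sub.
move=> e; apply/subsetP => B BBB.
have : hull CC (indicator R B) by rewrite -e; apply: hull_indicator.
(* among all sets, B is the only one on which w reaches #|B| *)
pose w t : R := if t \in B then 1 else -1.
have wB : weight w B = #|B|%:R.
  by rewrite weightE (eq_bigr (fun=> 1)) ?sumr_const // /w => t ->.
have wC C : weight w C = #|C :&: B|%:R - #|C :\: B|%:R.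
  rewrite weightE (big_setID B) /=; congr (_ + _).
    by rewrite (eq_bigr (fun=> 1)) ?sumr_const // /w => t /setIP[_ ->].
  rewrite (eq_bigr (fun=> -1)) ?sumr_const ?mulNrn // /w => t /setDP[_ /negbTE ->] //.
have le C : weight w C <= #|B|%:R.
  rewrite wC lerBlDr -natrD ler_nat; apply: leq_trans (leq_addr _ _).
  by apply/subset_leq_card/subsetIr.
move=> hB; have := hull_dot_max hB (fun C _ => le C) wB.
move=> /hull_neq0[C]; rewrite inE => /andP[CC' /eqP].
rewrite wC => /eqP; rewrite subr_eq -natrD eqr_nat => /eqP e1.
have := subset_leq_card (subsetIr C B) => e2.
suff -> : B = C by [].
have e3 : #|C :\: B| = 0%N by lia.
apply/eqP; rewrite eq_sym eqEcard -setD_eq0 -cards_eq0 e3 /=.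
by have := subset_leq_card (subsetIl C B); lia.
Qed.

Lemma hull_cap_heaviest BB S c x : S \subset BB -> hull S x -> hull (heaviest BB c) x ->
  hull (S :&: heaviest BB c) x.
Proof.
move=> sS hS hx; have [B0 B0h] := hull_neq0 hx.
have [hB eq] := (hull_heaviest x B0h).1 hx; have [B0B max] := heaviestP _ _ _ B0h.
have : hull [set B in S | weight c B == weight c B0] x.
  by apply: hull_dot_max => // B /(subsetP sS)/max.
apply: hullS; apply/subsetP => B; rewrite (heaviestE B0h) !inE => /andP[BS ->].
by rewrite BS (subsetP sS).
Qed.

Lemma cells_meet_same BB S c x : S \subset BB -> hull S x -> hull (heaviest BB c) x ->
  exists w, S :&: heaviest BB c = heaviest S w.
Proof.
move=> sS hS hx; have [B BI] := hull_neq0 (hull_cap_heaviest sS hS hx).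
by exists c; rewrite setIC; apply: heaviest_restrict => //; apply/set0Pn; exists B; rewrite setIC.
Qed.

(** Common points lie on the separating hyperplane, so both faces may be replaced
by their traces there, which are faces of the same polytope. *)
Lemma cells_meet_across BB1 BB2 BB3 l a S c x :
  (forall B, B \in BB1 -> weight l B <= a) ->
  (forall B, B \in BB2 -> a <= weight l B) ->
  BB3 = [set B in BB1 | weight l B == a] ->
  BB3 = [set B in BB2 | weight l B == a] ->
  S \subset BB1 -> hull S x -> hull (heaviest BB2 c) x ->
  hull (S :&: heaviest BB2 c) x /\ exists w, S :&: heaviest BB2 c = heaviest S w.
Proof.
move=> le ge E1 E2 sS hS hx.
have leS B : B \in S -> weight l B <= a by move=> /(subsetP sS)/le.
have geS' B : B \in heaviest BB2 c -> - weight l B <= - a.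
  by move=> /(subsetP (heaviest_sub _ _))/ge; rewrite lerN2.
have la : dot l x = a.
  apply/eqP; rewrite eq_le (hull_dot_le hS leS) -lerN2 -dotNl.
  by apply: hull_dot_le hx _ => B /geS'; rewrite /weight dotNl.
have h1 : hull (S :&: BB3) x.
  have := hull_dot_max hS leS la; apply: hullS; apply/subsetP => B.
  by rewrite E1 !inE => /andP[BS ->]; rewrite BS (subsetP sS).
have h2 : hull (heaviest BB2 c :&: BB3) x.
  have geN B : B \in heaviest BB2 c -> weight (fun t => - l t) B <= - a.
    by move=> /geS'; rewrite /weight dotNl.
  have := hull_dot_max hx geN; rewrite dotNl la => /(_ erefl); apply: hullS.
  apply/subsetP => B; rewrite E2 inE => /andP[Bh]; rewrite in_setI Bh inE.
  rewrite (subsetP (heaviest_sub _ _) _ Bh) /=.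
  by rewrite /weight dotNl eqr_opp.
have sB32 : BB3 \subset BB2 by rewrite E2; apply/subsetP => B /[!inE] /andP[].
have [B2 B2I] := hull_neq0 h2.
have r2 : heaviest BB2 c :&: BB3 = heaviest BB3 c.
  by apply: heaviest_restrict => //; apply/set0Pn; exists B2.
have h3 : hull ((S :&: BB3) :&: heaviest BB3 c) x.
  by apply: hull_cap_heaviest h1 _; rewrite ?subsetIr // -r2.
have eI : (S :&: BB3) :&: heaviest BB3 c = S :&: heaviest BB2 c.
  rewrite -r2; apply/setP => B; rewrite !in_setI.
  have [BS|//] := boolP (B \in S); have [Bh|] := boolP (B \in heaviest BB2 c); last first.
    by rewrite /= andbF.
  suff -> : B \in BB3 by [].
  rewrite E2 inE (subsetP (heaviest_sub _ _) _ Bh) /= eq_le leS //=.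
  exact/ge/(subsetP (heaviest_sub _ _) _ Bh).
have [B3 B3I] := hull_neq0 h3.
have [B1 B1I] := hull_neq0 h1.
have r1 : S :&: BB3 = heaviest S l.
  have B1h : B1 \in heaviest S l.
    move: B1I; rewrite E1 !inE => /andP[B1S /andP[_ /eqP e]].
    by rewrite B1S; apply/forallP => C; apply/implyP => /leS; rewrite e.
  rewrite (heaviestE B1h); move: B1I; rewrite E1 !inE => /andP[B1S /andP[_ /eqP ->]].
  apply/setP => B; rewrite !inE; by have [/(subsetP sS) ->|] := boolP (B \in S).
have [w wE] := heaviest_heaviest S l c.
split; first by rewrite -eI.
exists w; rewrite -eI -wE -r1 setIC; apply: heaviest_restrict; first exact: subsetIr.
by apply/set0Pn; exists B3; rewrite setIC.
Qed.

(** A segment ending at a relatively interior point can be continued beyond it. *)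
Lemma rel_interior_prolong BB x y : rel_interior (hull BB) x -> hull BB y ->
  exists2 e : R, 0 < e & hull BB (fun t => x t + e * (x t - y t)).
Proof.
move=> [hx [d d0 ball]] hy.
pose m := \sum_t `|x t - y t|.
have m0 : 0 <= m by apply: sumr_ge0.
pose e := d / (m + 1); have m1 : 0 < m + 1 by rewrite ltr_wpDl.
have e0 : 0 < e by apply: divr_gt0.
exists e => //; apply: ball.
  exists 2%N, (fun i => if i == ord0 then 1 + e else - e), (fun i => if i == ord0 then x else y).
  split=> [i||]; first by case: ifP.
    by rewrite big_ord_recl big_ord1 /= addrK.
  by apply/funext => t; rewrite /lincomb big_ord_recl big_ord1 /=; ring.
move=> t; rewrite addrAC subrr add0r normrM gtr0_norm //.
have : `|x t - y t| <= m by rewrite /m (bigD1 t) //= lerDl sumr_ge0.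
move=> le; rewrite /e mulrAC ltr_pdivrMr // ltr_pM2l //.
by apply: le_lt_trans le _; rewrite ltrDl.
Qed.

(** Let [c] be maximal at [x] over the lower part.  If [x] is strictly below the
hyperplane, then [c] is maximal at [x] over a neighbourhood of [x] in the whole
polytope, hence constant.  If [x] is on the hyperplane, [c] is constant on the
section; a single lower vertex with the same value of [c], prolonged through [x]
to the upper side, then transports this value to all lower vertices. *)
Lemma interior_heaviest BB l a c x (BB1 := [set B in BB | weight l B <= a]) :
  (forall y, hull BB y -> dot l y <= a -> hull BB1 y) ->
  rel_interior (hull BB) x -> hull (heaviest BB1 c) x ->
  heaviest BB1 c = BB1 \/ heaviest BB1 c = [set B in BB | weight l B == a].
Proof.
move=> cov ix hx; have [B0 B0h] := hull_neq0 hx.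
have [h1x cx] := (hull_heaviest x B0h).1 hx; have [B0B1 max] := heaviestP _ _ _ B0h.
have sB1 : BB1 \subset BB by apply/subsetP => B /[!inE] /andP[].
have le1 B : B \in BB1 -> weight l B <= a by rewrite inE => /andP[].
have lx : dot l x <= a by apply: hull_dot_le h1x le1.
have hBx : hull BB x by apply: hullS h1x.
have cle y : hull BB y -> dot l y <= a -> dot c y <= dot c x.
  by move=> hy ly; rewrite cx; apply: hull_dot_le (cov _ hy ly) max.
have all_heaviest : (forall B, B \in BB1 -> dot c x <= weight c B) -> heaviest BB1 c = BB1.
  move=> ge; apply/eqP; rewrite eqEsubset heaviest_sub; apply/subsetP => B BB1'.
  apply/heaviestP; split=> // C /max; rewrite -cx => /le_trans; apply; exact: ge.
move: lx; rewrite le_eqVlt => /orP[/eqP lx|lx]; last first.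
  (* step from x away from B, by little enough to stay below *)
  left; apply: all_heaviest => B BB1'.
  have [e e0 he] := rel_interior_prolong ix (hull_indicator R (subsetP sB1 _ BB1')).
  set y := fun t => _ in he.
  have dy w : dot w y = dot w x + e * (dot w x - weight w B).
    rewrite /y (dot_move w x (fun t => x t - indicator R B t)); congr (_ + _ * _).
    by rewrite /weight /dot -sumrB; apply: eq_bigr => t _; rewrite mulrBr.
  have [s [s0 s1 ls]] : exists s : R, [/\ 0 < s, s <= 1 & s * dot l y + (1 - s) * dot l x <= a].
    have [ly|ly] := leP (dot l y) a.
      by exists 1; split=> //; rewrite subrr mul0r addr0 mul1r.
    exists ((a - dot l x) / (dot l y - dot l x)).
    have p : 0 < dot l y - dot l x by rewrite subr_gt0; apply: lt_trans lx ly.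
    split; first by rewrite divr_gt0 // subr_gt0.
      by rewrite ler_pdivrMr // mul1r lerD2r ltW.
    have -> : forall u, u * dot l y + (1 - u) * dot l x = u * (dot l y - dot l x) + dot l x.
      by move=> u; ring.
    by rewrite divfK ?gt_eqF // subrK.
  have := cle (mix s y x); rewrite dot_mix => /(_ _ ls); rewrite dot_mix => h.
  have {}h := h (hull_mix (ltW s0) s1 he hBx).
  have {h} : s * dot c y + (1 - s) * dot c x - dot c x <= 0 by rewrite subr_le0.
  have -> : s * dot c y + (1 - s) * dot c x - dot c x = s * (dot c y - dot c x) by ring.
  rewrite pmulr_rle0 // dy => h.
  have : e * (dot c x - weight c B) <= 0 by lra.
  by rewrite pmulr_rle0 // subr_le0.
(* from here on x is on the hyperplane *)
have cconst y : hull BB y -> dot l y = a -> dot c y = dot c x.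
  move=> hy ly; apply/eqP; rewrite eq_le cle ?ly //=.
  have [e e0 he] := rel_interior_prolong ix hy.
  have dy w : dot w (fun t => x t + e * (x t - y t)) = dot w x + e * (dot w x - dot w y).
    rewrite (dot_move w x (fun t => x t - y t)); congr (_ + _ * _).
    by rewrite /dot -sumrB; apply: eq_bigr => t _; rewrite mulrBr.
  have := cle _ he; rewrite !dy lx ly subrr mulr0 addr0 => /(_ (lexx _)) h.
  have : e * (dot c x - dot c y) <= 0 by lra.
  by rewrite pmulr_rle0 // subr_le0.
have [/existsP[B /andP[Bh lB]]|noB] := boolP [exists B, (B \in heaviest BB1 c) && (weight l B < a)].
  left; apply: all_heaviest => C CB1.
  have cB : weight c B = dot c x.
    by move: Bh; rewrite (heaviestE B0h) inE cx => /andP[_ /eqP].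
  have BB' : B \in BB by apply: (subsetP sB1); apply: (subsetP (heaviest_sub _ _) _ Bh).
  have [e e0 he] := rel_interior_prolong ix (hull_indicator R BB').
  set y := fun t => _ in he.
  have dy w : dot w y = dot w x + e * (dot w x - weight w B).
    rewrite /y (dot_move w x (fun t => x t - indicator R B t)); congr (_ + _ * _).
    by rewrite /weight /dot -sumrB; apply: eq_bigr => t _; rewrite mulrBr.
  have ly : a < dot l y by rewrite dy lx ltrDl mulr_gt0 // subr_gt0.
  have p : 0 < dot l y - weight l C by rewrite subr_gt0; apply: le_lt_trans (le1 _ CB1) ly.
  (* the point of the segment from y to C that lies on the hyperplane *)
  pose s := (dot l y - a) / (dot l y - weight l C).
  have s0 : 0 < s by rewrite divr_gt0 // subr_gt0.
  have s1 : s <= 1 by rewrite ler_pdivrMr // mul1r lerD2l lerN2 le1.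
  have hm := hull_mix (ltW s0) s1 (hull_indicator R (subsetP sB1 _ CB1)) he.
  have := cconst _ hm; rewrite !dot_mix -/(weight _ C) => /(_ _).
  have e1 : s * weight l C + (1 - s) * dot l y = a.
    have -> : s * weight l C + (1 - s) * dot l y = dot l y - s * (dot l y - weight l C) by ring.
    by rewrite /s divfK ?gt_eqF // subKr.
  move=> /(_ e1); rewrite dy cB subrr mulr0 addr0 => h.
  have {h} : s * weight c C + (1 - s) * dot c x - dot c x = 0 by rewrite h subrr.
  have -> : s * weight c C + (1 - s) * dot c x - dot c x = s * (weight c C - dot c x) by ring.
  by move/eqP; rewrite mulf_eq0 gt_eqF //= subr_eq0 => /eqP ->.
right; apply/setP => B; rewrite [RHS]inE; apply/idP/andP => [Bh|[BBB /eqP lB]].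
  have := subsetP (heaviest_sub _ _) _ Bh; rewrite inE => /andP[-> lB]; split=> //.
  rewrite eq_le lB leNgt; apply: contra noB => lt; apply/existsP; exists B; exact/andP.
have B1' : B \in BB1 by rewrite inE BBB lB /=.
apply/heaviestP; split=> // C /max; rewrite -cx => /le_trans; apply.
by rewrite -(cconst _ (hull_indicator R BBB) lB).
Qed.

End Splitting.
(** * The g-polynomial and a single hyperplane *)

Section SplitFormula.
Variables (R : realType) (g : matroid_function) (hg : is_speyer_g R g).

Lemma speyer_bases (T : finType) (M N : matroid T) :
  ground M = ground N -> bases M = bases N -> g M = g N.
Proof.
move=> eg eb; apply: (speyer_iso hg); exists id; split.
- by move=> x y _ _.
- by rewrite imset_id.
- by rewrite -eb -[RHS]imset_id; apply: eq_imset => B; apply: imset_id.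
Qed.

Variables (T : finType) (M M1 M2 M3 : matroid T) (l : T -> R) (a : R) (z : T -> R).
Hypotheses (g1 : ground M1 = ground M) (g2 : ground M2 = ground M) (g3 : ground M3 = ground M).
Hypothesis b1 : bases M1 = [set B in bases M | weight l B <= a].
Hypothesis b2 : bases M2 = [set B in bases M | a <= weight l B].
Hypothesis b3 : bases M3 = [set B in bases M | weight l B == a].
Hypotheses (ex1 : symmetric_exchange (bases M1)) (ex2 : symmetric_exchange (bases M2)).
Hypothesis cov1 : forall y, hull (bases M) y -> dot l y <= a -> hull (bases M1) y.
Hypothesis cov2 : forall y, hull (bases M) y -> a <= dot l y -> hull (bases M2) y.
Hypothesis above : exists2 B, B \in bases M & a < weight l B.
Hypotheses (z3 : hull (bases M3) z) (zin : rel_interior (hull (bases M)) z).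

Let cell (S : {set {set T}}) :=
  exists w : T -> R, S = heaviest (bases M1) w \/ S = heaviest (bases M2) w.

Let cellb S := `[< cell S >].

Let bases_set0 (N : matroid T) : bases N != set0.
Proof. by apply/set0Pn; have [B BN] := bases_neq0 N; exists B. Qed.

Let cell_sub S : cell S -> S \subset bases M.
Proof.
case=> w [] ->; apply: subset_trans (heaviest_sub _ _) _.
  by rewrite b1; apply/subsetP => B /[!inE] /andP[].
by rewrite b2; apply/subsetP => B /[!inE] /andP[].
Qed.

Let cell_matroid S : cell S -> exists N : matroid T, ground N = ground M /\ bases N = S.
Proof.
move=> cS; apply: matroid_of_family.
- by case: cS => w [] ->; apply: heaviest_symmetric_exchange.
- by move=> B /(subsetP (cell_sub cS)) /bases_sub.
- by case: cS => w [] ->; apply/set0Pn; apply: heaviest_exists; apply: bases_set0.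
Qed.

Let le1 B : B \in bases M1 -> weight l B <= a.
Proof. by rewrite b1 inE => /andP[]. Qed.
Let ge2 B : B \in bases M2 -> a <= weight l B.
Proof. by rewrite b2 inE => /andP[]. Qed.
Let b31 : bases M3 = [set B in bases M1 | weight l B == a].
Proof.
by rewrite b3 b1; apply/setP => B; rewrite !inE; case: eqP => [->|]; rewrite ?lexx ?andbT ?andbF.
Qed.
Let b32 : bases M3 = [set B in bases M2 | weight l B == a].
Proof.
by rewrite b3 b2; apply/setP => B; rewrite !inE; case: eqP => [->|]; rewrite ?lexx ?andbT ?andbF.
Qed.

Let cells_meet S S' (x : T -> R) : cell S -> cell S' -> hull S x -> hull S' x ->
  hull (S :&: S') x /\ exists w : T -> R, S :&: S' = heaviest S w.
Proof.
move=> [w hw] [w' hw'] hS; case: hw' => -> hS'; case: hw => eS.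
- have sS : S \subset bases M1 by rewrite eS heaviest_sub.
  by split; [apply: hull_cap_heaviest|apply: cells_meet_same sS hS hS'].
- have sS : S \subset bases M2 by rewrite eS heaviest_sub.
  apply: (@cells_meet_across _ _ (bases M2) (bases M1) (bases M3) (fun t => - l t) (- a)) => //.
  + by move=> B /ge2; rewrite /weight dotNl lerN2.
  + by move=> B /le1; rewrite /weight dotNl lerN2.
  + by rewrite b32; apply/setP => B; rewrite !inE /weight dotNl eqr_opp.
  + by rewrite b31; apply/setP => B; rewrite !inE /weight dotNl eqr_opp.
- have sS : S \subset bases M1 by rewrite eS heaviest_sub.
  exact: (cells_meet_across le1 ge2 b31 b32 sS).
- have sS : S \subset bases M2 by rewrite eS heaviest_sub.
  by split; [apply: hull_cap_heaviest|apply: cells_meet_same sS hS hS'].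
Qed.

Let cell1 : cell (bases M1).
Proof. by exists (fun=> 0); left; rewrite heaviest0. Qed.
Let cell2 : cell (bases M2).
Proof. by exists (fun=> 0); right; rewrite heaviest0. Qed.
Let cell3 : cell (bases M3).
Proof.
have [B BM] := bases_neq0 M3; exists l; left; rewrite b31.
move: BM; rewrite b31 inE => /andP[B1 /eqP e].
rewrite (heaviestE (B0 := B)) ?e //; apply/heaviestP; split=> // C /le1.
by rewrite e.
Qed.

(* the point [z], pushed away from a basis above the hyperplane, gives one below *)
Let below : exists2 B, B \in bases M & weight l B < a.
Proof.
have [B BM lB] := above.
have [e e0 he] := rel_interior_prolong zin (hull_indicator R BM).
have lz : dot l z = a.
  by apply: hull_dot_eq z3 _ => C; rewrite b3 inE => /andP[_ /eqP].
have [/existsP[C /andP[CM lC]]|no] := boolP [exists C, (C \in bases M) && (weight l C < a)].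
  by exists C.
suff : - dot l (fun t => z t + e * (z t - indicator R B t)) <= - a.
  rewrite lerN2 (@dot_move _ _ l z (fun t => z t - indicator R B t) e) lz.
  have -> : dot l (fun t => z t - indicator R B t) = a - weight l B.
    by rewrite -lz /dot /weight /dot -sumrB; apply: eq_bigr => t _; rewrite mulrBr.
  by rewrite lerDl pmulr_rge0 // subr_ge0 leNgt lB.
rewrite -dotNl; apply: hull_dot_le he _ => C CM; rewrite /weight dotNl lerN2 leNgt.
by apply: contra no => lC; apply/existsP; exists C; rewrite CM.
Qed.

Let interior_cellE S : cell S ->
  ~ (hull S `<=` rel_boundary (hull (R := R) (bases M)))%classic <->
  [\/ S = bases M1, S = bases M2 | S = bases M3].
Proof.
move=> cS; split=> [nb|].
  have [x [hx nx]] : exists x : T -> R, hull S x /\ ~ rel_boundary (hull (bases M)) x.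
    apply: contrapT => no; apply: nb => x hx; apply: contrapT => nx; apply: no.
    by exists x.
  have hMx : hull (bases M) x by apply: hullS (cell_sub cS) hx.
  have ix : rel_interior (hull (bases M)) x.
    by apply: contrapT => nix; apply: nx; split.
  case: cS hx => w [] -> hx.
    move: hx cov1; rewrite b1 => hx cov; have := interior_heaviest cov ix hx.
    by rewrite -b1 -b3 => -[] ->; [constructor 1|constructor 3].
  have b2' : bases M2 = [set B in bases M | weight (fun t => - l t) B <= - a].
    by rewrite b2; apply/setP => B; rewrite !inE /weight dotNl lerN2.
  have b3' : bases M3 = [set B in bases M | weight (fun t => - l t) B == - a].
    by rewrite b3; apply/setP => B; rewrite !inE /weight dotNl eqr_opp.
  have cov y : hull (bases M) y -> dot (fun t => - l t) y <= - a -> hull (bases M2) y.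
    by rewrite dotNl lerN2; apply: cov2.
  move: hx cov; rewrite b2' => hx cov; have := interior_heaviest cov ix hx.
  by rewrite -b2' -b3' => -[] ->; [constructor 2|constructor 3].
have nbz : ~ rel_boundary (hull (bases M)) z by case=> _ /(_ zin).
have s31 : bases M3 \subset bases M1 by rewrite b31; apply/subsetP => B; rewrite inE => /andP[].
have s32 : bases M3 \subset bases M2 by rewrite b32; apply/subsetP => B; rewrite inE => /andP[].
by case=> -> sub; apply/nbz/sub => //; apply: hullS z3.
Qed.

(** The cells are the faces of the two parts; by [interior_cellE] the covaluative
sum is left with three of them.  They are distinct because there are bases
strictly on either side of the hyperplane. *)
Lemma speyer_hyperplane_split : g M = g M1 + g M2 + g M3.
Proof.
pose I : finType := {S : {set {set T}} | cellb S}.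
have cI (i : I) : cell (val i) by apply/asboolP; apply: (valP i).
have [N NP] : exists N : I -> matroid T, forall i, ground (N i) = ground M /\ bases (N i) = val i.
  have /choice[N NP] : forall i : I, exists P : matroid T, ground P = ground M /\ bases P = val i.
    by move=> i; apply: cell_matroid.
  by exists N.
have polyE (i : I) : base_polytope (R := R) (N i) = hull (val i).
  by rewrite -(NP i).2.
have ne (k : I) : val k != set0 by rewrite -(NP k).2; apply: bases_set0.
pose mk S (cS : cell S) : I := exist cellb S (introT (asboolP _) cS).
have sub : matroid_subdivision R M N.
  split=> [i||x|i F|i j Q Q0].
  - by case: (NP i).
  - by move=> i j; rewrite !polyE => /hull_inj/val_inj.
  - split=> [hx|[i]]; last by rewrite polyE; apply/hullS/cell_sub/cI.
    have [lx|/ltW lx] := leP (dot l x) a.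
      by exists (mk _ cell1); rewrite polyE; apply: cov1.
    by exists (mk _ cell2); rewrite polyE; apply: cov2.
  - rewrite polyE => /(face_hull _ (ne i))[w ->].
    have cF : cell (heaviest (val i) w).
      have [c [] ->] := cI i.
        by have [w' ->] := heaviest_heaviest (bases M1) c w; exists w'; left.
      by have [w' ->] := heaviest_heaviest (bases M2) c w; exists w'; right.
    by exists (mk _ cF); rewrite polyE.
  have [x [hix hjx]] : exists x : T -> R, hull (val i) x /\ hull (val j) x.
    apply: contrapT => no; apply: Q0; apply/funext => x; apply/propext; split=> // -[].
    by rewrite !polyE => hi hj; apply: no; exists x.
  suff half (i' j' : I) : hull (val i') x -> hull (val j') x ->
      face (hull (R := R) (val i')) (hull (val i') `&` hull (val j'))%classic.
    rewrite /Q !polyE; split; first exact: half.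
    by rewrite classical_sets.setIC; apply: half.
  move=> hi hj; apply: (face_hull _ (ne i')).2.
  have [_ [w wE]] := cells_meet (cI i') (cI j') hi hj.
  exists w; rewrite -wE; apply/funext => y; apply/propext; split=> [[hy hy']|hy].
    by have [] := cells_meet (cI i') (cI j') hy hy'.
  by split; [apply: hullS (subsetIl _ _) hy|apply: hullS (subsetIr _ _) hy].
rewrite (speyer_covaluative hg sub).
have inE3 i : `[< interior_cell R M (N i) >] =
    [|| val i == bases M1, val i == bases M2 | val i == bases M3].
  apply/asboolP/or3P => [|h]; rewrite /interior_cell polyE.
    move/(interior_cellE (cI i)).
    by case=> ->; [constructor 1|constructor 2|constructor 3].
  apply/(interior_cellE (cI i)).
  by case: h => /eqP ->; [constructor 1|constructor 2|constructor 3].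
have gN i P : ground P = ground M -> val i = bases P -> g (N i) = g P.
  by move=> gP bP; apply: speyer_bases; rewrite ?(NP i).1 ?(NP i).2.
have n12 : bases M1 != bases M2.
  have [B BM lB] := below; apply/eqP => /setP/(_ B); rewrite b1 b2 !inE BM (ltW lB) /=.
  by rewrite leNgt lB.
have n13 : bases M1 != bases M3.
  have [B BM lB] := below; apply/eqP => /setP/(_ B); rewrite b1 b3 !inE BM (ltW lB) /=.
  by rewrite lt_eqF.
have n23 : bases M2 != bases M3.
  have [B BM lB] := above; apply/eqP => /setP/(_ B); rewrite b2 b3 !inE BM (ltW lB) /=.
  by rewrite gt_eqF.
have mkE (i : I) S (cS : cell S) : (i == mk S cS) = (val i == S) by [].
rewrite (bigD1 (mk _ cell1)) ?inE3 ?eqxx //= (gN _ M1) //.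
rewrite (bigD1 (mk _ cell2)) /=; last by rewrite inE3 !mkE /= eqxx orbT eq_sym.
rewrite (gN _ M2) // (bigD1 (mk _ cell3)) /=; last first.
  by rewrite inE3 !mkE /= eqxx !orbT ![bases M3 == _]eq_sym n13 n23.
rewrite (gN _ M3) // big1 ?addr0 ?addrA // => i.
rewrite inE3 !mkE => /andP[/andP[/andP[+ /negbTE n1] /negbTE n2] /negbTE n3].
by rewrite n1 n2 n3.
Qed.

End SplitFormula.
(** * Inequality descriptions *)

Section MoveToNewFacet.
Variables (R : realType) (T C : finType) (Q : pred C) (l : C -> T -> R) (u : C -> R).
Implicit Types (x d : T -> R).

Definition satisfies x := forall c, Q c -> dot (l c) x <= u c.
Definition slack x := [set c | Q c && (dot (l c) x < u c)].

(** The step length is the least ratio of slack to growth over the inequalities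
that grow along [d], as in the ratio test of the simplex method. *)
Lemma move_to_new_facet x d c0 : satisfies x -> Q c0 -> 0 < dot (l c0) d ->
  (forall c, Q c -> dot (l c) x = u c -> dot (l c) d = 0) ->
  exists2 s : R, 0 < s &
    satisfies (fun t => x t + s * d t) /\ slack (fun t => x t + s * d t) \proper slack x.
Proof.
move=> feas Q0 d0 tight.
pose P c := Q c && (0 < dot (l c) d).
have P0 : P c0 by rewrite /P Q0.
pose ratio c := (u c - dot (l c) x) / dot (l c) d.
have [c /andP[Qc dc] minc] : exists2 c, P c & forall c', P c' -> ratio c <= ratio c'.
  exists [arg min_(c < c0 | P c) ratio c]%O; by case: arg_minP.
have slc : dot (l c) x < u c.
  rewrite lt_neqAle feas // andbT; apply: contraTneq dc => /(tight _ Qc) ->.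
  by rewrite ltxx.
have s0 : 0 < ratio c by rewrite divr_gt0 // subr_gt0.
exists (ratio c) => //.
have fy : satisfies (fun t => x t + ratio c * d t).
  move=> c' Qc'; rewrite dot_move; have [le|gt] := leP (dot (l c') d) 0.
    by have := feas _ Qc'; have : ratio c * dot (l c') d <= 0; [rewrite pmulr_rle0|lra].
  by have := minc c'; rewrite /P Qc' gt => /(_ isT); rewrite [leRHS]/ratio ler_pdivlMr //; lra.
split=> //; apply/properP; split.
  apply/subsetP => c'; rewrite !inE dot_move => /andP[Qc' lt]; rewrite Qc' lt_neqAle feas // andbT.
  by apply: contraTneq lt => e; rewrite (tight _ Qc' e) mulr0 addr0 e ltxx.
exists c; first by rewrite inE Qc.
by rewrite inE dot_move /ratio divfK ?gt_eqF // addrC subrK ltxx andbF.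
Qed.

End MoveToNewFacet.

Section Rounding.
Variables (R : realType) (T : finType).
Implicit Types (A B F G : {set T}) (w x y z : T -> R).

Lemma dot_indicator A x : dot (indicator R A) x = \sum_(t in A) x t.
Proof.
rewrite /dot [RHS]big_mkcond; apply: eq_bigr => t _; rewrite /indicator.
by case: (t \in A); rewrite ?mul1r ?mul0r.
Qed.

Lemma dot_transfer w i j : dot w (fun t => (t == i)%:R - (t == j)%:R) = w i - w j.
Proof.
have one k : \sum_t w t * (t == k)%:R = w k.
  rewrite (bigD1 k) //= eqxx mulr1 big1 ?addr0 // => t /negbTE ->; exact: mulr0.
by rewrite /dot; under eq_bigr do rewrite mulrBr; rewrite sumrB !one.
Qed.

Lemma weight_indicator A B : weight (indicator R A) B = #|B :&: A|%:R.
Proof.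
rewrite /weight dot_indicator -sum1_card natr_sum [RHS]big_mkcond [LHS]big_mkcond /=.
apply: eq_bigr => t _; rewrite inE /indicator.
by case: (t \in A); case: (t \in B).
Qed.

Lemma sum_setUI F G x :
  \sum_(t in F) x t + \sum_(t in G) x t = \sum_(t in F :|: G) x t + \sum_(t in F :&: G) x t.
Proof.
rewrite [X in _ + X](big_setID F) /= [X in _ = X + _](big_setID F) /=.
have -> : (F :|: G) :&: F = F by rewrite setUK.
have -> : (F :|: G) :\: F = G :\: F by rewrite setDUl setDv set0U.
by rewrite [G :&: F]setIC; ring.
Qed.

(** A sum that is an integer cannot have exactly one non-integral term. *)
Lemma fractional_partner (D : {set T}) x i (p q : nat) :
  (forall t, t \in D -> 0 <= x t <= 1) -> \sum_(t in D) x t = p%:R - q%:R ->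
  i \in D -> 0 < x i < 1 -> exists j, [/\ j \in D, j != i & 0 < x j < 1].
Proof.
move=> box sumD iD /andP[x0 x1]; apply: contrapT => no.
have int t : t \in D -> t != i -> x t = (x t == 1)%:R.
  move=> tD ti; have /andP[] := box t tD; rewrite le_eqVlt => /orP[/eqP <-|t0].
    by rewrite eq_sym oner_eq0.
  rewrite le_eqVlt => /orP[/eqP ->|t1]; first by rewrite eqxx.
  by case: no; exists t; rewrite t0 t1.
move: sumD; rewrite (big_setD1 i) //=.
rewrite (eq_bigr (fun t => (x t == 1)%:R)); last first.
  by move=> t /setD1P[ti tD]; apply: int.
rewrite -natr_sum; set m := (\sum_(t in _) _)%N => e.
have e1 : x i = p%:R - (q + m)%N%:R by rewrite natrD; lra.
move: x0 x1; rewrite e1 subr_gt0 ltr_nat ltrBlDl natr1 ltr_nat; lia.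
Qed.

Variables (E : {set T}) (K : nat) (S : {set {set T}}) (b : {set T} -> nat).

Definition cut_index : finType := ((T + T) + {set T})%type.

Definition cut_active (c : cut_index) := match c with
  | inl (inl t) => t \in E | inl (inr t) => t \in E | inr F => F \in S end.

Definition cut_form (c : cut_index) : T -> R := match c with
  | inl (inl t) => indicator R [set t]
  | inl (inr t) => fun s => - indicator R [set t] s
  | inr F => indicator R F end.

Definition cut_bound (c : cut_index) : R := match c with
  | inl (inl t) => 1 | inl (inr t) => 0 | inr F => (b F)%:R end.

Definition on_slice x := (forall t, t \notin E -> x t = 0) /\ \sum_(t in E) x t = K%:R.

Definition cut_polytope x :=
  [/\ on_slice x, forall t, t \in E -> 0 <= x t <= 1 &
      forall F, F \in S -> \sum_(t in F) x t <= (b F)%:R].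

Lemma dot_form_le t x : dot (cut_form (inl (inl t))) x = x t.
Proof. by rewrite dot_indicator big_set1. Qed.
Lemma dot_form_ge t x : dot (cut_form (inl (inr t))) x = - x t.
Proof. by rewrite /= dotNl dot_indicator big_set1. Qed.
Lemma dot_form_cut F x : dot (cut_form (inr F)) x = \sum_(t in F) x t.
Proof. exact: dot_indicator. Qed.

Lemma cut_polytopeE x : cut_polytope x <-> on_slice x /\ satisfies cut_active cut_form cut_bound x.
Proof.
split=> [[sl box cut]|[sl sat]].
  split=> // -[[t|t]|F] /= h.
  - by rewrite dot_form_le; case/andP: (box t h).
  - by rewrite dot_form_ge oppr_le0; case/andP: (box t h).
  - by rewrite dot_form_cut cut.
split=> // [t tE|F FS].
  have := sat (inl (inl t)) tE; have := sat (inl (inr t)) tE.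
  by rewrite dot_form_le dot_form_ge /= oppr_le0 => -> ->.
by have := sat (inr F) FS; rewrite dot_form_cut.
Qed.

Lemma hull_cut x : hull (cut_bases E K S b) x -> cut_polytope x.
Proof.
move=> hx; have xt t : x t = dot (indicator R [set t]) x by rewrite dot_indicator big_set1.
have le1 t : weight (indicator R [set t]) =1 fun B => (t \in B)%:R.
  move=> B; rewrite weight_indicator; have [tB|tB] := boolP (t \in B).
    by rewrite (setIidPr _) ?cards1 // sub1set.
  by rewrite disjoint_setI0 ?cards0 // disjoint_sym disjoints1.
split; first split.
- move=> t tE; rewrite xt; apply: hull_dot_eq hx _ => B /cut_basesP[sB _ _].
  by rewrite le1; have [/(subsetP sB)|//] := boolP (t \in B); rewrite (negbTE tE).
- rewrite -dot_indicator; apply: hull_dot_eq hx _ => B /cut_basesP[sB cB _].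
  by rewrite weight_indicator (setIidPl sB) cB.
- move=> t _; rewrite xt; apply/andP; split.
    rewrite -oppr_le0 -dotNl; apply: hull_dot_le hx _ => B _.
    by rewrite /weight dotNl -/(weight _ B) le1 oppr_le0 ler0n.
  by apply: hull_dot_le hx _ => B _; rewrite le1; case: (_ \in _); rewrite ?ler01.
move=> F FS; rewrite -dot_indicator; apply: hull_dot_le hx _ => B /cut_basesP[_ _ bB].
by rewrite weight_indicator ler_nat bB.
Qed.

Hypothesis comp : compatible_cuts E K S b.

Let sumE_sub F x : F \subset E -> \sum_(t in E) x t = \sum_(t in F) x t + \sum_(t in E :\: F) x t.
Proof. by move=> sF; rewrite (big_setID F) /= (setIidPr sF). Qed.

(** If two cuts are tight, then x is 0 outside their union and 1 on their
intersection. *)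
Lemma tight_cuts_partition x F G t : cut_polytope x -> F \in S -> G \in S -> F != G ->
  \sum_(t in F) x t = (b F)%:R -> \sum_(t in G) x t = (b G)%:R ->
  0 < x t < 1 -> (t \in G) = (t \notin F).
Proof.
move=> [[sl0 slK] box _] FS GS nFG tF tG /andP[x0 x1].
have [sub pair] := comp; have sF := sub _ FS; have sG := sub _ GS.
have tE : t \in E by apply: contraTT x0 => /sl0 ->; rewrite ltxx.
have sU : F :|: G \subset E by rewrite subUset sF.
have UI := sum_setUI F G x.
have leU : \sum_(t in E :\: (F :|: G)) x t = K%:R - \sum_(t in F :|: G) x t.
  by rewrite -slK (sumE_sub x sU) addrC addKr.
have leI : \sum_(t in F :&: G) (1 - x t) = #|F :&: G|%:R - \sum_(t in F :&: G) x t.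
  by rewrite sumrB sumr_const.
have geU : 0 <= \sum_(t in E :\: (F :|: G)) x t.
  by apply: sumr_ge0 => s /setDP[sE _]; case/andP: (box s sE).
have geI : 0 <= \sum_(t in F :&: G) (1 - x t).
  by apply: sumr_ge0 => s /setIP[/(subsetP sF) sE _]; rewrite subr_ge0; case/andP: (box s sE).
have := pair _ _ FS GS nFG; rewrite -(ler_nat R) !natrD -tF -tG UI => le.
have eU : \sum_(t in E :\: (F :|: G)) x t = 0 by lra.
have eI : \sum_(t in F :&: G) (1 - x t) = 0 by lra.
have [tF'|tF'] := boolP (t \in F).
  apply/negbTE/negP => tG'; have tI : t \in F :&: G by rewrite inE tF'.
  have := eI; rewrite (big_setD1 t) //=.
  have : 0 <= \sum_(s in (F :&: G) :\ t) (1 - x s).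
    by apply: sumr_ge0 => s /setD1P[_ /setIP[/(subsetP sF) sE _]]; rewrite subr_ge0; case/andP: (box s sE).
  lra.
apply: contraT => tG'; have tD : t \in E :\: (F :|: G) by rewrite !inE (negbTE tF') (negbTE tG').
have := eU; rewrite (big_setD1 t) //=.
have : 0 <= \sum_(s in (E :\: (F :|: G)) :\ t) x s.
  by apply: sumr_ge0 => s /setD1P[_ /setDP[sE _]]; case/andP: (box s sE).
lra.
Qed.

(** Up to complement, the fractional coordinates see at most one tight cut, and
its two sides both have an integral sum. *)
Lemma fractional_pair x i : cut_polytope x -> 0 < x i < 1 ->
  exists j, [/\ j != i, 0 < x j < 1 & forall F, F \in S ->
     \sum_(t in F) x t = (b F)%:R -> (i \in F) = (j \in F)].
Proof.
move=> px xi; have [[sl0 slK] box cut] := px; have [sub pair] := comp.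
have iE : i \in E by apply: contraTT xi => /sl0 ->; rewrite ltxx.
have boxS (D : {set T}) : D \subset E -> forall t, t \in D -> 0 <= x t <= 1.
  by move=> sD t /(subsetP sD); apply: box.
have [F /andP[FS /eqP tF]|none] := pickP (fun F => (F \in S) && (\sum_(t in F) x t == (b F)%:R)); last first.
  have [|j [jE ji xj]] := @fractional_partner E x i K 0 box _ iE xi; first by rewrite slK subr0.
  by exists j; split=> // F FS tF; have := none F; rewrite FS tF eqxx.
have sF := sub _ FS.
have [j [ji xj eF]] : exists j, [/\ j != i, 0 < x j < 1 & (i \in F) = (j \in F)].
  have [iF|iF] := boolP (i \in F).
    have [|j [jF ji xj]] := @fractional_partner F x i (b F) 0 (boxS _ sF) _ iF xi.
      by rewrite tF subr0.
    by exists j.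
  have iD : i \in E :\: F by rewrite inE iF.
  have [|j [/setDP[_ jF] ji xj]] := @fractional_partner (E :\: F) x i K (b F) (boxS _ (subsetDl _ _)) _ iD xi.
    by rewrite -slK -tF (sumE_sub x sF) addrC addKr.
  by exists j; rewrite (negbTE jF).
exists j; split=> // G GS tG; have [<- //|nFG] := eqVneq F G.
by rewrite !(tight_cuts_partition px FS GS nFG tF tG) // eF.
Qed.

(** Moving weight from [j] to [i] preserves all tight inequalities, and cannot go
on for ever since x i <= 1. *)
Lemma transfer_exists x i j : cut_polytope x -> i != j -> 0 < x i < 1 -> 0 < x j < 1 ->
  (forall F, F \in S -> \sum_(t in F) x t = (b F)%:R -> (i \in F) = (j \in F)) ->
  exists2 s : R, 0 < s &
    cut_polytope (fun t => x t + s * ((t == i)%:R - (t == j)%:R)) /\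
    slack cut_active cut_form cut_bound (fun t => x t + s * ((t == i)%:R - (t == j)%:R))
      \proper slack cut_active cut_form cut_bound x.
Proof.
move=> px ij xi xj same; have [[sl0 slK] sat] := (cut_polytopeE x).1 px.
have inE' k : 0 < x k < 1 -> k \in E by apply: contraTT => /sl0 ->; rewrite ltxx.
have iE := inE' _ xi; have jE := inE' _ xj.
case/andP: (xi) => xi0 xi1; case/andP: (xj) => xj0 xj1.
pose d t : R := (t == i)%:R - (t == j)%:R.
have [||s s0 [sat' pr]] := @move_to_new_facet R T cut_index cut_active cut_form cut_bound x d (inl (inl i)) sat iE.
- by rewrite dot_form_le /d eqxx (negbTE ij) subr0 ltr01.
- move=> [[t|t]|F] /= act.
  + rewrite !dot_form_le /= /d => e; case: eqP e => [->|_] e; first by lra.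
    by case: eqP e => [->|_] e; first lra; rewrite subrr.
  + rewrite !dot_form_ge /= /d => e; case: eqP e => [->|_] e; first by lra.
    by case: eqP e => [->|_] e; first lra; rewrite subrr oppr0.
  + rewrite dot_form_cut => /(same _ act) e.
    by rewrite dot_transfer /indicator e subrr.
exists s => //; split=> //; apply/cut_polytopeE; split=> //; split.
  move=> t tE; rewrite sl0 // add0r.
  have [ti tj] : t != i /\ t != j by split; apply: contraNneq tE => ->.
  by rewrite (negbTE ti) (negbTE tj) subrr mulr0.
by rewrite -dot_indicator dot_move dot_transfer /indicator iE jE subrr mulr0 addr0 dot_indicator.
Qed.

(** By induction on the number of inequalities that are not tight: a fractional
point is between the end points of a segment along which two coordinates trade
weight. *)
Lemma cut_hull x : cut_polytope x -> hull (cut_bases E K S b) x.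
Proof.
pose sl := slack cut_active cut_form cut_bound.
have [m] := ubnP #|sl x|; elim: m x => // m IHm x ltm px.
have [[sl0 slK] box cut] := px.
have [i xi|int] := pickP (fun i => 0 < x i < 1); last first.
  pose B := [set t in E | x t == 1].
  have xB : x = indicator R B.
    apply/funext => t; rewrite /indicator inE; have [tE|/sl0 ->//] := boolP (t \in E).
    have := int t; have := box t tE; case/andP; rewrite le_eqVlt => /orP[/eqP <-|-> /=].
      by rewrite [0 == 1]eq_sym oner_eq0.
    by rewrite le_eqVlt => /orP[/eqP ->|->]; rewrite ?eqxx.
  have sB : B \subset E by apply/subsetP => t /[!inE] /andP[].
  rewrite xB; apply: hull_indicator; apply/cut_basesP; split=> //.
    have := slK; rewrite xB -dot_indicator -/(weight _ _) weight_indicator (setIidPl sB).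
    by move/eqP; rewrite eqr_nat => /eqP.
  move=> F FS; have := cut F FS.
  by rewrite xB -dot_indicator -/(weight _ _) weight_indicator ler_nat.
have [j [ji xj same]] := fractional_pair px xi.
have ij : i != j by rewrite eq_sym.
have [s s0 [py ys]] := transfer_exists px ij xi xj same.
have [|s' s'0 [pz zs]] := transfer_exists px ji xj xi.
  by move=> F FS /(same _ FS).
set y := fun t => _ in py ys; set z := fun t => _ in pz zs.
have ss : 0 < s + s' by apply: addr_gt0.
have -> : x = mix (s' / (s + s')) y z.
  by apply/funext => t; rewrite /mix /y /z; field; rewrite gt_eqF.
apply: hull_mix.
- by rewrite divr_ge0 ?ltW.
- by rewrite ler_pdivrMr // mul1r lerDr ltW.
- by apply: IHm py; apply: leq_trans (proper_card ys) _.
- by apply: IHm pz; apply: leq_trans (proper_card zs) _.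
Qed.

Lemma affine_hull_dot_eq (P : classical_sets.set (T -> R)) w y a :
  (forall x, P x -> dot w x = a) -> affine_hull P y -> dot w y = a.
Proof.
move=> eq [m [c [u [uP c1 ->]]]]; rewrite /dot /lincomb.
under eq_bigr do rewrite mulr_sumr.
rewrite exchange_big /= -[RHS]mul1r -c1 mulr_suml; apply: eq_bigr => i _.
by rewrite -(eq _ (uP i)) /dot mulr_sumr; apply: eq_bigr => t _; ring.
Qed.

Lemma cut_rel_interior z : on_slice z -> (forall t, t \in E -> 0 < z t < 1) ->
  (forall F, F \in S -> \sum_(t in F) z t < (b F)%:R) ->
  rel_interior (hull (cut_bases E K S b)) z.
Proof.
move=> slz box strict.
have pz : cut_polytope z.
  split=> // [t /box /andP[? ?]|F /strict /ltW //]; by rewrite !ltW.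
split; first exact: cut_hull.
have [|d d0 dP] := @positive_lower_bound R cut_index cut_active
    (fun c => cut_bound c - dot (cut_form c) z).
  move=> [[t|t]|F] /= act; rewrite subr_gt0.
  - by rewrite dot_form_le; case/andP: (box t act).
  - by rewrite dot_form_ge oppr_lt0; case/andP: (box t act).
  - by rewrite dot_form_cut strict.
have nT : 0 < #|T|%:R + 1 :> R by rewrite ltr_wpDl.
exists (d / (#|T|%:R + 1)); first exact: divr_gt0.
move=> y ay close; apply: cut_hull; apply/cut_polytopeE; split; first split.
- move=> t tE; have := @affine_hull_dot_eq _ (indicator R [set t]) y 0 _ ay.
  rewrite dot_indicator big_set1; apply=> x /hull_cut[[x0 _] _ _].
  by rewrite dot_indicator big_set1 x0.
- rewrite -dot_indicator; apply: affine_hull_dot_eq ay => x /hull_cut[[_ xK] _ _].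
  by rewrite dot_indicator.
move=> c act; have := dP c act.
have : dot (cut_form c) y - dot (cut_form c) z <= d.
  rewrite /dot -sumrB; apply: (@le_trans _ _ (\sum_(t : T) d / (#|T|%:R + 1))).
    apply: ler_sum => t _; rewrite -mulrBr; apply: le_trans (ler_norm _) _.
    rewrite normrM; apply: le_trans (ltW (close t)).
    rewrite -[leRHS]mul1r ler_wpM2r //.
    by case: c {act} => [[u|u]|F]; rewrite /= ?normrN /indicator; case: (t \in _); rewrite ?normr1 ?normr0 ?ler01.
  rewrite sumr_const -[leLHS]mulr_natr mulrAC ler_pdivrMr // ler_pM2l // lerDl ler01 //.
lra.
Qed.

End Rounding.
(** * Recognizing uniform and cuspidal matroids *)

Local Open Scope nat_scope.

Section Isomorphisms.
Variables (R : realType) (g : matroid_function) (hg : is_speyer_g R g).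

Lemma speyer_relabel (T1 T : finType) (M1 : matroid T1) (M : matroid T) (f : T1 -> T) :
  injective f -> f @: ground M1 = ground M ->
  (forall B : {set T1}, B \subset ground M1 -> (f @: B \in bases M) = (B \in bases M1)) -> g M = g M1.
Proof.
move=> inj fE fB; symmetry; apply: (speyer_iso hg); exists f; split=> //.
  by move=> x y _ _; apply: inj.
apply/setP => C; apply/imsetP/idP => [[B BM ->]|CM]; first by rewrite fB // bases_sub.
have CE : C = f @: (f @^-1: C :&: ground M1).
  apply/setP => t; apply/idP/imsetP => [tC|[s /setIP[]]]; last by rewrite inE => h _ ->.
  have : t \in f @: ground M1 by rewrite fE (subsetP (bases_sub CM)).
  by case/imsetP => s sG ts; exists s => //; rewrite !inE -ts tC.
exists (f @^-1: C :&: ground M1) => //; by rewrite -fB ?subsetIr // -CE.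
Qed.

Variable (T : finType).
Implicit Types (E F B : {set T}) (M : matroid T).

Lemma imset_enum_val_setT E : [set enum_val i | i in [set: 'I_#|E|]] = E.
Proof.
apply/setP => t; apply/imsetP/idP => [[i _ ->]|tE]; first exact: enum_valP.
by exists (enum_rank_in tE t); rewrite // enum_rankK_in.
Qed.

Lemma card_imset_enum_val E (B : {set 'I_#|E|}) : #|[set enum_val i | i in B]| = #|B|.
Proof. by rewrite card_imset //; apply: enum_val_inj. Qed.

Lemma imset_enum_val_sub E (B : {set 'I_#|E|}) : [set enum_val i | i in B] \subset E.
Proof. by apply/subsetP => t /imsetP[i _ ->]; apply: enum_valP. Qed.

Lemma speyer_uniform E K M b : K <= #|E| -> ground M = E ->
  bases M = cut_bases E K set0 b -> g M = g (uniform K #|E|).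
Proof.
move=> leK gM bM; apply: (speyer_relabel (f := @enum_val _ (mem E))).
- exact: enum_val_inj.
- by rewrite gM; apply: imset_enum_val_setT.
move=> B _; rewrite bM [RHS]inE (minn_idPl leK); apply/cut_basesP/eqP.
  by case=> _; rewrite card_imset_enum_val.
move=> cB; split; first exact: imset_enum_val_sub.
  by rewrite card_imset_enum_val.
by move=> F; rewrite inE.
Qed.

Lemma speyer_uniform_sum E F K M (b : {set T} -> nat) : F \subset E -> F != set0 ->
  b F <= K -> b F <= #|F| -> K - b F <= #|E :\: F| -> b (E :\: F) = K - b F ->
  ground M = E -> bases M = cut_bases E K [set F; E :\: F] b ->
  g M = (g (uniform (b F) #|F|) * g (uniform (K - b F) #|E :\: F|))%R.
Proof.
move=> sF Fn0 leK leF leD bD gM bM; rewrite -(speyer_dsum hg).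
pose f (s : 'I_#|F| + 'I_#|E :\: F|) := match s with inl i => enum_val i | inr j => enum_val j end.
have notF (j : 'I_#|E :\: F|) : enum_val j \notin F by have /setDP[] := enum_valP j.
have injf : injective f.
  move=> [i|i] [j|j] /= e.
  - by congr inl; apply: enum_val_inj.
  - by have := enum_valP i; rewrite e => h; have := notF j; rewrite h.
  - by have := enum_valP j; rewrite -e => h; have := notF i; rewrite h.
  - by congr inr; apply: enum_val_inj.
have fE A1 A2 : f @: sum_set A1 A2 = [set enum_val i | i in A1] :|: [set enum_val j | j in A2].
  by rewrite /sum_set imsetU -!imset_comp.
have setDF (A1 : {set T}) : A1 \subset E -> A1 :&: (E :\: F) = A1 :\: F.
  by move=> sA; rewrite setIDA (setIidPl sA).
apply: (speyer_relabel (f := f)) => //.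
  rewrite gM fE !imset_enum_val_setT; apply/setP => t; rewrite !inE.
  by have [/(subsetP sF)|] := boolP (t \in F).
move=> B _.
pose B1 := [set i | inl i \in B]; pose B2 := [set j | inr j \in B].
have -> : B = sum_set B1 B2.
  by apply/setP => -[i|j]; rewrite ?sum_set_inl ?sum_set_inr inE.
have e1 : f @: sum_set B1 B2 :&: F = [set enum_val i | i in B1].
  rewrite fE setIUl (setIidPl (imset_enum_val_sub _)).
  have /disjoint_setI0 -> : [disjoint [set enum_val j | j in B2] & F].
    by apply/pred0P => t /=; apply/negbTE/negP => /andP[/imsetP[j _ ->]]; apply/negP.
  by rewrite setU0.
have e2 : f @: sum_set B1 B2 :\: F = [set enum_val j | j in B2].
  rewrite fE setDUl.
  have -> : [set enum_val i | i in B1] :\: F = set0.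
    by apply/eqP; rewrite setD_eq0 imset_enum_val_sub.
  rewrite set0U; apply/setDidPl/pred0P => t /=; apply/negbTE/negP => /andP[/imsetP[j _ ->]]; exact/negP.
have sE : f @: sum_set B1 B2 \subset E.
  rewrite fE subUset (subset_trans (imset_enum_val_sub _) sF).
  exact: subset_trans (imset_enum_val_sub _) (subsetDl _ _).
have cB := cardsID F (f @: sum_set B1 B2).
rewrite e1 e2 !card_imset_enum_val in cB.
rewrite bM; apply/cut_basesP/imset2P.
  case=> _ cK cut; exists B1 B2 => //; rewrite inE (minn_idPl _) //.
    have := cut F; rewrite !inE eqxx => /(_ isT); have := cut (E :\: F).
    rewrite !inE eqxx orbT setDF // e1 e2 !card_imset_enum_val bD => /(_ isT).
    move=> h1 h2; have cBK := etrans cB cK; apply/eqP; lia.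
  have := cut F; rewrite !inE eqxx => /(_ isT); have := cut (E :\: F).
  rewrite !inE eqxx orbT setDF // e1 e2 !card_imset_enum_val bD => /(_ isT).
  move=> h1 h2; have cBK := etrans cB cK; apply/eqP; lia.
case=> C1 C2; rewrite !inE (minn_idPl leF) (minn_idPl leD) => /eqP c1 /eqP c2 eC.
have eB1 : B1 = C1 by apply/setP => i; rewrite -(sum_set_inl C1 C2) -eC sum_set_inl.
have eB2 : B2 = C2 by apply/setP => i; rewrite -(sum_set_inr C1 C2) -eC sum_set_inr.
split=> //; first by rewrite -cB eB1 eB2; lia.
move=> G; rewrite !inE => /orP[]/eqP ->; first by rewrite e1 card_imset_enum_val eB1 c1.
by rewrite setDF // e2 card_imset_enum_val eB2 c2 bD.
Qed.

Lemma height_cuspidal_upper p a r b i :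
  height (cuspidal_upper p a r b) i = minn i p + minn (i - (p + a)) r.
Proof.
have ct c j m : count id (take j (nseq m c)) = if c then minn j m else 0.
  have [le|lt] := leqP j m.
    by rewrite take_nseq // count_nseq; case: c; rewrite /= ?mul1n ?mul0n.
  rewrite take_oversize; last by rewrite size_nseq; apply: ltnW.
  by rewrite count_nseq; case: c; rewrite /= ?mul1n ?mul0n.
have ctcat (s1 s2 : seq bool) j : count id (take j (s1 ++ s2)) =
    count id (take j s1) + count id (take (j - size s1) s2).
  rewrite take_cat; case: ltnP => [lt|ge]; last by rewrite count_cat (take_oversize ge).
  by rewrite (eqP (ltnW lt)) take0 addn0.
rewrite /height /cuspidal_upper !ctcat !ct !size_nseq.
by rewrite add0n addn0 subnDA.
Qed.

Lemma height_lip (w : seq bool) m i : m <= i -> height w m <= height w i <= height w m + (i - m).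
Proof.
move=> le; rewrite /height.
have -> : count id (take i w) = count id (take m w) + count id (take (i - m) (drop m w)).
  by rewrite -count_cat -takeD subnKC.
rewrite leq_addr leq_add2l; apply: leq_trans (count_size _ _) _.
by rewrite size_take_min geq_minl.
Qed.

(** As a path rises by at most one per step and by [p + r] in total, it stays below
the upper path as soon as it does so at the inner corner, after [p + a] steps. *)
Lemma mem_cuspidal p a r b (B : {set 'I_(p + a + r + b)}) :
  (B \in bases (cuspidal p a r b)) =
  (#|B| == p + r) && (#|[set j in B | j < p + a]| <= p).
Proof.
apply/cuspidal_basesP/andP => [[cB hB]|[/eqP cB hB]].
  split; first exact/eqP.
  have := hB (p + a); rewrite height_cuspidal_upper subnn; lia.
split=> // i lei; rewrite height_cuspidal_upper.
move: cB hB; rewrite -(north_steps_surj B); set w := [tuple _ | _ < _] => cB.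
rewrite -!height_card => hB.
have hn : height w i <= p + r.
  by rewrite height_card -cB; apply: subset_leq_card; apply/subsetP => j; rewrite inE => /andP[].
have z0 : height w 0 = 0 by rewrite /height take0.
have := height_lip w (leq0n i); rewrite z0 => h0.
have [le|lt] := leqP i (p + a).
  by have := height_lip w le; lia.
by have := height_lip w (ltnW lt); lia.
Qed.

(** The positions 0, ..., p + a - 1 of the lattice path become the complement of
[F], and the last ones become [F]. *)
Lemma speyer_cuspidal E F K M (b : {set T} -> nat) : F \subset E -> F != set0 ->
  b F <= K -> b F <= #|F| -> K - b F <= #|E :\: F| -> b (E :\: F) = K - b F ->
  ground M = E -> bases M = cut_bases E K [set E :\: F] b ->
  g M = g (cuspidal (K - b F) (#|E| + b F - (K + #|F|)) (b F) (#|F| - b F)).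
Proof.
move=> sF /set0Pn[t0 t0F] leK leF leD bD gM bM.
have cE : #|E :\: F| + #|F| = #|E| by rewrite -(cardsID F E) (setIidPr sF) addnC.
set p := K - b F; set a := _ - _; set r := b F; set c := _ - _.
have pa : p + a = #|E :\: F| by rewrite /p /a; lia.
have rc : r + c = #|F| by rewrite /r /c; lia.
pose s := enum (E :\: F) ++ enum F.
have sz : size s = p + a + r + c by rewrite size_cat -!cardE; lia.
have us : uniq s.
  rewrite cat_uniq !enum_uniq andbT /=; apply/hasPn => t.
  by rewrite !mem_enum !inE => ->.
pose f (i : 'I_(p + a + r + c)) := nth t0 s i.
have injf : injective f.
  move=> i j /eqP; rewrite nth_uniq ?sz ?ltn_ord // => /eqP; exact: val_inj.
have sE t : (t \in s) = (t \in E).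
  rewrite mem_cat !mem_enum inE; have [/(subsetP sF)->|] := boolP (t \in F) => //.
  by rewrite orbF.
have fE i : f i \in E by rewrite -sE mem_nth // sz.
have fF i : (f i \in F) = ~~ (i < p + a).
  rewrite /f nth_cat -cardE -pa; case: ltnP => h /=.
    by apply/negbTE; have := mem_nth t0 (s := enum (E :\: F)) (n := i);
      rewrite -cardE -pa h mem_enum => /(_ isT) /setDP[].
  rewrite -mem_enum mem_nth // -cardE; have := ltn_ord i; lia.
apply: (speyer_relabel (f := f)) => //.
  rewrite gM; apply/setP => t; apply/imsetP/idP => [[i _ ->] //|].
  rewrite -sE => ts; have lt : index t s < p + a + r + c by rewrite -sz index_mem.
  by exists (Ordinal lt) => //; rewrite /f /= nth_index.
move=> B _; rewrite mem_cuspidal bM.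
have e1 : #|(f @: B) :&: (E :\: F)| = #|[set j in B | j < p + a]|.
  rewrite -(card_imset _ injf); congr #|pred_of_set _|; apply/setP => t.
  apply/setIP/imsetP => [[/imsetP[i iB ->]]|[i]].
    by rewrite inE fF negbK => /andP[lt _]; exists i; rewrite // inE iB.
  by rewrite inE => /andP[iB lt] ->; split; [apply: imset_f|rewrite inE fF negbK lt fE].
have pr : p + r = K by rewrite /p /r subnK.
apply/cut_basesP/andP => [[_ cK cut]|[/eqP cB hB]].
  rewrite -(card_imset _ injf) cK pr; split=> //.
  by rewrite -e1; have := cut (E :\: F); rewrite inE eqxx bD => /(_ isT).
split.
- by apply/subsetP => t /imsetP[i _ ->].
- by rewrite card_imset // cB.
by move=> G /set1P ->; rewrite e1 bD.
Qed.

End Isomorphisms.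
(** * Cutting off one flat *)

Section CutOneFlat.
Variables (R : realType) (g : matroid_function) (hg : is_speyer_g R g).
Variables (T : finType) (E : {set T}) (K : nat) (S : {set {set T}}) (b : {set T} -> nat) (F : {set T}).
Hypotheses (comp : compatible_cuts E K (F |: S) b) (FS : F \notin S).
Hypotheses (b0 : 0 < b F) (bK : b F < K) (bF : b F < #|F|) (bD : K - b F < #|E :\: F|).
Hypothesis strict : forall G, G \in S -> F :&: G = set0 -> F :|: G = E -> K < b F + b G.

Let D := E :\: F.
Let b' (G : {set T}) := if G == F then b F else K - b F.

Let sF : F \subset E. Proof. by case: comp => sub _; apply: sub; rewrite setU11. Qed.
Let Fn0 : F != set0. Proof. by apply: contraTneq bF => ->; rewrite cards0. Qed.
Let DF : D != F.
Proof.
have /set0Pn[t tF] := Fn0; apply/eqP => e.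
by have := tF; rewrite -e inE tF.
Qed.
Let b'F : b' F = b F. Proof. by rewrite /b' eqxx. Qed.
Let b'D : b' D = K - b F. Proof. by rewrite /b' (negbTE DF). Qed.

Let compS : compatible_cuts E K S b.
Proof.
case: comp => sub pair; split=> [G GS|G H GS HS]; first by apply: sub; rewrite setU1r.
by apply: pair; rewrite setU1r.
Qed.

Let compFD : compatible_cuts E K [set F; D] b'.
Proof.
have disj : F :&: D = set0 by rewrite /D setIDA [F :&: E]setIC -setIDA setDv setI0.
split=> [G /set2P[] -> //|G H /set2P[] -> /set2P[] ->]; rewrite ?eqxx ?subsetDl //.
  by rewrite disj cards0 b'F b'D; lia.
by rewrite setIC disj cards0 b'F b'D; lia.
Qed.

Let compD : compatible_cuts E K [set D] b'.
Proof.
by split=> [G /set1P -> |G H /set1P -> /set1P ->]; rewrite ?eqxx ?subsetDl.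
Qed.

Let cardD (B : {set T}) : B \subset E -> #|B| = K -> #|B :&: F| + #|B :&: D| = K.
Proof. by move=> sB <-; rewrite /D setIDA (setIidPl sB) cardsID. Qed.

Let cut_below : cut_bases E K (F |: S) b = [set B in cut_bases E K S b | #|B :&: F| <= b F].
Proof.
apply/setP => B; rewrite inE; apply/cut_basesP/andP => [[sB cB cut]|[/cut_basesP[sB cB cut] cF]].
  split; last by apply: cut; rewrite setU11.
  by apply/cut_basesP; split=> // G GS; apply: cut; rewrite setU1r.
by split=> // G /setU1P[->|/cut].
Qed.

Let cut_above : cut_bases E K [set D] b' = [set B in cut_bases E K S b | b F <= #|B :&: F|].
Proof.
apply/setP => B; rewrite inE; apply/cut_basesP/andP => [[sB cB cut]|[/cut_basesP[sB cB cut] cF]].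
  have cBD := cardD sB cB; have := cut D (set11 _); rewrite b'D => cD.
  have cF : b F <= #|B :&: F| by lia.
  split=> //; apply/cut_basesP; split=> // G GS.
  have nFG : F != G by apply: contraNneq FS => ->.
  have := comp.2 _ _ (setU11 _ _) (setU1r F GS) nFG.
  have := cardsUI (B :&: F) (B :&: G).
  rewrite -setIUr -setIIr; have := subset_leq_card (subsetIl B (F :|: G)).
  have := subset_leq_card (subsetIr B (F :&: G)); lia.
by split=> // G /set1P ->; rewrite b'D; have := cardD sB cB; lia.
Qed.

Let cut_equal : cut_bases E K [set F; D] b' = [set B in cut_bases E K S b | #|B :&: F| == b F].
Proof.
apply/setP => B; rewrite inE; apply/cut_basesP/andP => [[sB cB cut]|[BS /eqP cF]].
  have := cut F (set21 _ _); rewrite b'F => cF.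
  have : B \in cut_bases E K [set D] b'.
    by apply/cut_basesP; split=> // G /set1P ->; apply: cut; rewrite set22.
  by rewrite cut_above inE => /andP[-> ge]; rewrite eqn_leq cF ge.
have [sB cB _] := cut_basesP _ _ _ _ _ BS; split=> // G /set2P[] ->.
  by rewrite b'F cF.
by rewrite b'D; have := cardD sB cB; lia.
Qed.

Local Open Scope ring_scope.

(* spreading weight evenly over F and over its complement avoids every cut but F *)
Let z (t : T) : R :=
  if t \in F then (b F)%:R / #|F|%:R else if t \in E then (K - b F)%:R / #|D|%:R else 0.

Let F0 : 0 < #|F|%:R :> R. Proof. by rewrite ltr0n; lia. Qed.
Let D0 : 0 < #|D|%:R :> R. Proof. by rewrite ltr0n; move: bD; rewrite -/D; lia. Qed.

Let zF : \sum_(t in F) z t = (b F)%:R.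
Proof.
rewrite (eq_bigr (fun=> (b F)%:R / #|F|%:R)); last by move=> t; rewrite /z => ->.
by rewrite sumr_const -[LHS]mulr_natr divfK ?gt_eqF.
Qed.

Let zD : \sum_(t in D) z t = (K - b F)%N%:R.
Proof.
rewrite (eq_bigr (fun=> (K - b F)%N%:R / #|D|%:R)); last first.
  by move=> t; rewrite /z inE => /andP[/negbTE -> ->].
by rewrite sumr_const -[LHS]mulr_natr divfK ?gt_eqF.
Qed.

Let sumE (x : T -> R) : \sum_(t in E) x t = \sum_(t in F) x t + \sum_(t in D) x t.
Proof. by rewrite (big_setID F) /= (setIidPr sF). Qed.

Let z_slice : on_slice E K z.
Proof.
split=> [t tE|]; last by rewrite sumE zF zD -natrD subnKC // ltnW.
by rewrite /z (negbTE tE) ifN //; apply: contra tE; apply: (subsetP sF).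
Qed.

Let z_box t : t \in E -> 0 < z t < 1.
Proof.
move=> tE; rewrite /z tE; case: ifP => _; apply/andP; split.
- by apply: divr_gt0; rewrite ?ltr0n //; lia.
- by rewrite ltr_pdivrMr // mul1r ltr_nat.
- by apply: divr_gt0; rewrite // ltr0n subn_gt0.
- by rewrite ltr_pdivrMr // mul1r ltr_nat.
Qed.

Let z_strict G : G \in S -> \sum_(t in G) z t < (b G)%:R.
Proof.
move=> GS; have nFG : F != G by apply: contraNneq FS => ->.
have sG : G \subset E by case: compS => sub _; apply: sub.
have sU : F :|: G \subset E by rewrite subUset sF.
have UI := sum_setUI F G z; rewrite zF in UI.
have eU : \sum_(t in F :|: G) z t + \sum_(t in E :\: (F :|: G)) z t = K%:R.
  by rewrite -z_slice.2 [RHS](big_setID (F :|: G)) /= (setIidPr sU).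
have eI : \sum_(t in F :&: G) z t + \sum_(t in F :&: G) (1 - z t) = #|F :&: G|%:R.
  by rewrite sumrB sumr_const addrC subrK.
have pos (A : {set T}) (h : T -> R) : (forall t, t \in A -> 0 < h t) ->
    0 <= \sum_(t in A) h t ?= iff (A == set0).
  move=> h0; split; first by apply: sumr_ge0 => t /h0/ltW.
  rewrite eq_sym; have [->|[t tA]] := set_0Vmem A; first by rewrite big_set0 !eqxx.
  have /negbTE -> : A != set0 by apply/set0Pn; exists t.
  rewrite (big_setD1 t) //= gt_eqF // ltr_pwDl ?h0 // sumr_ge0 // => s /setD1P[_ /h0/ltW //].
have [pU pU0] := pos (E :\: (F :|: G)) z (fun t => fun tD => (andP (z_box (proj1 (setDP tD)))).1).
have [|pI pI0] := pos (F :&: G) (fun t => 1 - z t).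
  by move=> t /setIP[/(subsetP sF)/z_box/andP[_ ?] _]; rewrite subr_gt0.
have := comp.2 _ _ (setU11 _ _) (setU1r F GS) nFG; rewrite -(ler_nat R) !natrD => le.
have [U0|nU] := eqVneq (E :\: (F :|: G)) set0; last first.
  have : 0 < \sum_(t in E :\: (F :|: G)) z t by rewrite lt_neqAle pU0 nU.
  lra.
have [I0|nI] := eqVneq (F :&: G) set0; last first.
  have : 0 < \sum_(t in F :&: G) (1 - z t) by rewrite lt_neqAle pI0 nI.
  lra.
have UE : F :|: G = E by apply/eqP; rewrite eqEsubset sU -setD_eq0 U0 eqxx.
have := strict GS I0 UE; rewrite -(ltr_nat R) natrD.
by move: UI eU; rewrite U0 I0 !big_set0 => *; lra.
Qed.

Let z_hull : hull (cut_bases E K [set F; D] b') z.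
Proof.
apply: cut_hull => //; split=> // [t /z_box/andP[? ?]|G /set2P[] ->]; first by rewrite !ltW.
  by rewrite zF b'F.
by rewrite zD b'D.
Qed.

Let cut_matroid S' b'' : compatible_cuts E K S' b'' -> cut_bases E K S' b'' != set0 ->
  exists M : matroid T, ground M = E /\ bases M = cut_bases E K S' b''.
Proof.
move=> l n0; apply: matroid_of_family => //; first exact: cut_symmetric_exchange.
exact: cut_bases_sub.
Qed.

(** Beyond the hyperplane x(F) = b F all other cuts hold automatically, so the
part cut off depends on [F] only: it is a cuspidal matroid. *)
Lemma speyer_cut (M : matroid T) : ground M = E -> bases M = cut_bases E K S b ->
  exists M1 : matroid T, [/\ ground M1 = E, bases M1 = cut_bases E K (F |: S) b &
    g M = g M1 + correction g (b F) K #|F| #|E|].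
Proof.
move=> gM bM; have [B3 B3M] := hull_neq0 z_hull.
have B3S : B3 \in cut_bases E K S b by move: B3M; rewrite cut_equal inE => /andP[].
have cB3 : #|B3 :&: F| = b F by move: B3M; rewrite cut_equal inE => /andP[_ /eqP].
have [M1 [g1 b1]] : exists M1 : matroid T, ground M1 = E /\ bases M1 = cut_bases E K (F |: S) b.
  by apply: cut_matroid => //; apply/set0Pn; exists B3; rewrite cut_below inE B3S cB3 /=.
have [M2 [g2 b2]] : exists M2 : matroid T, ground M2 = E /\ bases M2 = cut_bases E K [set D] b'.
  by apply: cut_matroid => //; apply/set0Pn; exists B3; rewrite cut_above inE B3S cB3 /=.
have [M3 [g3 b3]] : exists M3 : matroid T, ground M3 = E /\ bases M3 = cut_bases E K [set F; D] b'.
  by apply: cut_matroid => //; apply/set0Pn; exists B3.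
exists M1; split=> //.
have -> : correction g (b F) K #|F| #|E| = g M2 + g M3.
  have cE : #|E| = (#|D| + #|F|)%N by rewrite -(cardsID F E) (setIidPr sF) addnC.
  rewrite /correction; congr (_ + _).
    rewrite (@speyer_cuspidal R g hg T E F K M2 b' sF Fn0) ?b'F ?b'D //; by [apply: ltnW|rewrite ltnW].
  have -> : (#|E| - #|F|)%N = #|D| by rewrite cE addnK.
  rewrite (@speyer_uniform_sum R g hg T E F K M3 b' sF Fn0) ?b'F ?b'D //; by [apply: ltnW|rewrite ltnW].
rewrite addrA.
apply: (@speyer_hyperplane_split R g hg T M M1 M2 M3 (indicator R F) (b F)%:R z).
- by rewrite g1 gM.
- by rewrite g2 gM.
- by rewrite g3 gM.
- by rewrite b1 bM cut_below; apply/setP => B; rewrite !inE weight_indicator ler_nat.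
- by rewrite b2 bM cut_above; apply/setP => B; rewrite !inE weight_indicator ler_nat.
- by rewrite b3 bM cut_equal; apply/setP => B; rewrite !inE weight_indicator eqr_nat.
- by rewrite b1; apply: cut_symmetric_exchange.
- by rewrite b2; apply: cut_symmetric_exchange.
- move=> y; rewrite bM b1 dot_indicator => /hull_cut[sl box cut] le.
  by apply: cut_hull => //; split=> // G /setU1P[->|/cut].
- move=> y; rewrite bM b2 dot_indicator => /hull_cut[[sl0 slK] box cut] ge.
  apply: cut_hull => //; split=> // G /set1P ->; rewrite b'D natrB; last exact: ltnW.
  by move: slK; rewrite sumE; lra.
- have [sB3 cB3K _] := cut_basesP _ _ _ _ _ B3S.
  have cB3D := cardD sB3 cB3K.
  have /card_gt0P[s /setIP[sB3' sD]] : (0 < #|B3 :&: D|)%N.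
    by move: cB3D; rewrite cB3 => /(canRL (addKn _)) ->; rewrite subn_gt0.
  have /setDP[sE sF'] := sD.
  have : (0 < #|F :\: B3|)%N by rewrite cardsD setIC cB3 subn_gt0.
  case/card_gt0P => t /setDP[tF tB3].
  have cB : #|(t |: B3 :\ s) :&: F| = (b F).+1 by rewrite card_swap_in // cB3.
  exists (t |: B3 :\ s); last by rewrite weight_indicator ltr_nat cB.
  have : t |: B3 :\ s \in cut_bases E K [set D] b'.
    have sB : t |: B3 :\ s \subset E.
      by rewrite subUset sub1set (subsetP sF) //=; apply: subset_trans sB3; apply: subD1set.
    have cBK : #|t |: B3 :\ s| = K by rewrite card_exchange.
    apply/cut_basesP; split=> // G /set1P ->; rewrite b'D leq_subRL ?(ltnW bK) //.
    by rewrite -(cardD sB cBK) cB leq_add2r leqnSn.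
  by rewrite bM cut_above inE => /andP[].
- by rewrite b3.
- by rewrite bM; apply: cut_rel_interior.
Qed.

End CutOneFlat.

(** * Elementary split matroids *)

Section ElementarySplit.
Local Open Scope ring_scope.
Variables (R : realType) (g : matroid_function) (hg : is_speyer_g R g).

(** By induction on the set of flats that have been cut off, starting from the
uniform matroid and ending at [N]. *)
Lemma speyer_elementary_split (T : finType) (N : matroid T) :
  connected N -> elementary_split N -> (1 < #|ground N|)%N ->
  g N = g (uniform (mrank N) #|ground N|)
    - \sum_(F in proper_cyclic_flats N) correction g (rk N F) (mrank N) #|F| #|ground N|.
Proof.
move=> conN splN gt1; set Z := proper_cyclic_flats N; set E := ground N; set K := mrank N.
have comp (S : {set {set T}}) : S \subset Z -> compatible_cuts E K S (rk N).
  move=> sS; split=> [F /(subsetP sS)/pcf_sub //|F G /(subsetP sS) FZ /(subsetP sS) GZ].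
  exact: pcf_pair.
have leK : (K <= #|E|)%N.
  by have [B BN] := bases_neq0 N; rewrite /K (mrank_card BN) subset_leq_card ?bases_sub.
have [B0 B0N] := bases_neq0 N.
have B0cut (S : {set {set T}}) : S \subset Z -> B0 \in cut_bases E K S (rk N).
  move=> sS; apply/cut_basesP; split; first exact: bases_sub.
    by rewrite /K (mrank_card B0N).
  by move=> F _; rewrite setIC; apply: rk_ge.
have partial (S : {set {set T}}) : S \subset Z -> forall M : matroid T, ground M = E ->
    bases M = cut_bases E K S (rk N) ->
    g M = g (uniform K #|E|) - \sum_(F in S) correction g (rk N F) K #|F| #|E|.
  have [m] := ubnP #|S|; elim: m S => // m IHm S ltm sS M gM bM.
  have [S0|[F FS]] := set_0Vmem S.
    by rewrite S0 big_set0 subr0; apply: (speyer_uniform hg leK gM); rewrite bM S0.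
  have FZ := subsetP sS _ FS.
  have sS' : S :\ F \subset Z by apply: subset_trans sS; apply: subD1set.
  have SE : F |: (S :\ F) = S by rewrite setD1K.
  have [M' [gM' bM']] : exists M' : matroid T, ground M' = E /\ bases M' = cut_bases E K (S :\ F) (rk N).
    apply: matroid_of_family; first exact/cut_symmetric_exchange/comp.
      exact: cut_bases_sub.
    by apply/set0Pn; exists B0; apply: B0cut.
  have [|||||||M1 [g1 b1 e1]] := @speyer_cut R g hg T E K (S :\ F) (rk N) F _ _ _ _ _ _ _ M' gM' bM'.
  - by rewrite SE; apply: comp.
  - by rewrite !inE eqxx.
  - exact: pcf_rk_gt0 FZ.
  - exact: pcf_rk_mrank.
  - exact: pcf_rk_card.
  - exact: pcf_corank FZ.
  - by move=> G /(subsetP sS') GZ; apply: pcf_strict_pair.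
  have -> : g M = g M1 by apply: (speyer_bases hg); rewrite ?gM ?bM ?b1 ?SE.
  have lt : (#|S :\ F| < m)%N by move: ltm; rewrite (cardsD1 F S) FS ltnS.
  have := IHm _ lt sS' M' gM' bM'; rewrite e1 (big_setD1 F FS) /= => e2.
  by rewrite opprD addrA addrAC -e2 addrK.
apply: partial => //; apply/setP => B; apply/basis_cyclic_flatP/cut_basesP => //.
Qed.

End ElementarySplit.
(** * The reduced flats *)

Section Reduction.
Local Open Scope nat_scope.
Variables (T : finType) (M : matroid T) (e v : T) (le : rel T).
Hypotheses (conM : connected M) (splM : elementary_split M) (gt1 : 1 < #|ground M|).
Hypotheses (vE : v \in ground M :\ e) (ord : total_order_on (ground M) le).
Implicit Types (A F G : {set T}).
Let K := mrank M.
Let flats := inner_flats M e :|: outer_flats M e.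

(** An element with the fewest elements below it is a minimum. *)
Lemma min_elt_in x0 A : A \subset ground M -> A != set0 -> min_elt le x0 A \in A.
Proof.
case: ord => tot _ trans sA /set0Pn[a aA]; rewrite /min_elt; case: pickP => [x /andP[] //|none].
have [x xA minx] := @arg_minnP _ a [in A] (fun x => #|[set y in A | le y x]|) aA.
have := none x; rewrite xA /= => /negbT; rewrite negb_forall => /existsP[y].
rewrite negb_imply => /andP[yA nxy].
have xE := subsetP sA _ xA; have yE := subsetP sA _ yA.
have yx : le y x by have := tot _ _ xE yE; rewrite (negbTE nxy).
have := minx y yA; rewrite leqNgt => /negP[]; apply: proper_card; apply/properP; split.
  apply/subsetP => z; rewrite !inE => /andP[zA zy]; rewrite zA.
  by apply: trans zy yx => //; apply: (subsetP sA).
by exists x; rewrite !inE xA //=; have := tot _ _ xE xE; rewrite orbb.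
Qed.

Let ve : v != e. Proof. by case/setD1P: vE. Qed.

Lemma flats_pcf F : F \in flats -> F \in proper_cyclic_flats M.
Proof. by rewrite !inE => /orP[]/andP[]. Qed.

Lemma flats_inner F : F \in flats -> e \in F -> 2 <= #|F| - rk M F.
Proof. by rewrite !inE => /orP[]/andP[_ /andP[]] // /negbTE ->. Qed.

Lemma flats_outer F : F \in flats -> e \notin F -> 2 <= K - rk M F.
Proof. by rewrite !inE => /orP[]/andP[_ /andP[]] // ->. Qed.

Lemma reduced_flat_inner F : F \in flats -> e \in F ->
  reduced_flat M e v le F \subset F /\ #|reduced_flat M e v le F| = #|F| - 2.
Proof.
move=> FF eF; have FZ := flats_pcf FF; have bF := flats_inner FF eF.
have [w /setD1P[we wF] ->] : exists2 w, w \in F :\ e & reduced_flat M e v le F = F :\: [set e; w].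
  rewrite /reduced_flat eF; case: ifP => vF; first by exists v => //; rewrite !inE ve.
  exists (min_elt le e (F :\ e)) => //; apply: min_elt_in.
    by apply: subset_trans (pcf_sub FZ); apply: subD1set.
  by rewrite -card_gt0; move: bF (cardsD1 e F); rewrite eF; clear; lia.
split; first exact: subsetDl.
rewrite cardsD (setIidPr _) ?cards2 1?eq_sym ?we //.
by apply/subsetP => u /set2P[] ->.
Qed.

Lemma reduced_flat_outer F : F \in flats -> e \notin F ->
  #|reduced_flat M e v le F :&: F| >= #|F| - 1 /\ #|reduced_flat M e v le F| = #|F|.
Proof.
move=> FF eF; have FZ := flats_pcf FF; have pF := flats_outer FF eF.
rewrite /reduced_flat (negbTE eF); case: ifP => vF; last by rewrite setIid leq_subr.
have : min_elt le e (ground M :\: (e |: F)) \in ground M :\: (e |: F).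
  apply: min_elt_in; first exact: subsetDl.
  rewrite -card_gt0 setUC -setDDl; have := cardsD1 e (ground M :\: F).
  by have := pcf_corank conM gt1 FZ; move: pF; rewrite /K; case: (e \in _); clear; lia.
set y := min_elt _ _ _; rewrite !inE negb_or => /andP[/andP[_ yF] _].
split; last by rewrite card_exchange.
apply: leq_trans (subset_leq_card (_ : F :\ v \subset _)).
  by rewrite (cardsD1 v F) vF addKn.
by apply/subsetP => u; rewrite !inE => /andP[-> ->]; rewrite orbT.
Qed.

(** A reduced flat differs from its flat in so few elements that two flats with
the same reduction would have an intersection larger than [pcf_pair] allows;
this is where the conditions b_F >= 2 and p_F >= 2 are needed. *)
Lemma reduced_flat_inj (N : matroid T) :
  (forall F, F \in flats -> rk N (reduced_flat M e v le F) = reduced_rank M e F) ->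
  {in flats &, injective (reduced_flat M e v le)}.
Proof.
move=> rkN F G FF GG eR; apply/eqP/negPn/negP => nFG.
have FZ := flats_pcf FF; have GZ := flats_pcf GG.
have rFG := rkN _ GG; rewrite -eR rkN // /reduced_rank in rFG.
have pFG := pcf_pair splM FZ GZ nFG.
have F0 := pcf_rk_gt0 conM gt1 FZ; have G0 := pcf_rk_gt0 conM gt1 GZ.
have F1 := pcf_rk_card FZ; have F2 := pcf_rk_mrank FZ.
set A := reduced_flat M e v le F in eR rFG.
have UI : #|A :&: F| + #|A :&: G| <= #|A| + #|F :&: G|.
  rewrite -cardsUI -setIUr -setIIr.
  by apply: leq_add; apply: subset_leq_card; rewrite ?subsetIl ?subsetIr.
case: ifP rFG => [eF|/negbT eF]; case: ifP => [eG|/negbT eG] rFG.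
- have [sF cF] := reduced_flat_inner FF eF; have [sG _] := reduced_flat_inner GG eG.
  have : #|e |: A| <= #|F :&: G|.
    by apply: subset_leq_card; rewrite subUset sub1set inE eF eG subsetI sF eR sG.
  have -> : #|e |: A| = #|A|.+1.
    by rewrite cardsU1 /A /reduced_flat eF; case: ifP => _; rewrite !inE eqxx.
  by move: (flats_inner FF eF) cF rFG pFG F0 G0 F2; rewrite -/A /K; clear; lia.
- have [sF cF] := reduced_flat_inner FF eF; have [sG cG] := reduced_flat_outer GG eG.
  move: (flats_inner FF eF) (flats_outer GG eG) cF sG cG F0 rFG pFG UI.
  by rewrite -eR -/A (setIidPl sF) -/A /K; clear; lia.
- have [sF cF] := reduced_flat_outer FF eF; have [sG cG] := reduced_flat_inner GG eG.
  move: (flats_outer FF eF) (flats_inner GG eG) cF sF cG G0 rFG pFG UI.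
  rewrite -eR in sG; rewrite -eR; by rewrite -/A (setIidPl sG) -/A /K; clear; lia.
have [sF cF] := reduced_flat_outer FF eF; have [sG cG] := reduced_flat_outer GG eG.
move: (flats_outer FF eF) (flats_outer GG eG) cF sF sG cG F1 rFG pFG UI.
by rewrite -eR -/A /K; clear; lia.
Qed.

End Reduction.

Local Open Scope ring_scope.

Lemma speyer_reduction (R : realType) (g : matroid_function) (hg : is_speyer_g R g)
    (T : finType) (M : matroid T) (e v : T) (le : rel T) (N : matroid T) :
  (4 <= #|ground M|)%N -> connected M -> elementary_split M -> e \in ground M ->
  v \in ground M :\ e -> total_order_on (ground M) le -> is_reduction M e v le N ->
  g T N = g _ (uniform (mrank M - 1) (#|ground M| - 2))
    - \sum_(F in inner_flats M e)
        correction g (rk M F - 1) (mrank M - 1) (#|F| - 2) (#|ground M| - 2)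
    - \sum_(F in outer_flats M e)
        correction g (rk M F) (mrank M - 1) #|F| (#|ground M| - 2).
Proof.
move=> n4 conM splM eE vE ord [gN /andP[conN splN] rN pcfN rkN].
have gt1 : (1 < #|ground M|)%N by apply: leq_trans n4.
have cN : #|ground N| = (#|ground M| - 2)%N.
  have /setD1P[ve vM] := vE.
  rewrite gN cardsD (setIidPr _) ?cards2 1?eq_sym ?ve //.
  by apply/subsetP => u /set2P[] ->.
have gt1N : (1 < #|ground N|)%N by rewrite cN; lia.
rewrite (speyer_elementary_split hg conN splN gt1N) cN rN -subn1 pcfN.
rewrite big_imset /=; last exact: (reduced_flat_inj conM splM gt1 vE ord rkN).
set flats := inner_flats M e :|: outer_flats M e in rkN *.
rewrite (bigID (fun F : {set T} => e \in F)) /= opprD addrA; congr (_ - _ - _).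
  apply: eq_big => [F|F /andP[FF eF]].
    by rewrite !inE; case: (e \in F); rewrite /= ?andbT ?andbF ?orbF.
  rewrite (rkN _ FF) (reduced_flat_inner vE ord FF eF).2.
  by rewrite /reduced_rank eF -subn1.
apply: eq_big => [F|F /andP[FF eF]].
  by rewrite !inE; case: (e \in F); rewrite /= ?andbT ?andbF ?orbF.
rewrite (rkN _ FF) (reduced_flat_outer v conM gt1 ord FF eF).2.
by rewrite /reduced_rank (negbTE eF).
Qed.

Theorem corollary5p3 (R : realType) (g : matroid_function)
    (hg : is_speyer_g R g)
    (T : finType) (M : matroid T) (k n : nat) (e : T)
    (hn : #|ground M| = n) (n4 : (4 <= n)%N) (hk : mrank M = k)
    (hM : connected M) (hMsplit : elementary_split M)
    (he : e \in ground M)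
    (hdel : connected (delete M e)) (hcon : connected (contract M e)) :
  (forall (v : T) (le : rel T) (N : matroid T),
     v \in ground M :\ e -> total_order_on (ground M) le ->
     is_reduction M e v le N ->
     g T N = g _ (uniform (k - 1) (n - 2))
       - \sum_(F in inner_flats M e)
           correction g (rk M F - 1) (k - 1) (#|F| - 2) (n - 2)
       - \sum_(F in outer_flats M e)
           correction g (rk M F) (k - 1) #|F| (n - 2)) /\
  (forall (v v' : T) (le le' : rel T) (N N' : matroid T),
     v \in ground M :\ e -> v' \in ground M :\ e ->
     total_order_on (ground M) le -> total_order_on (ground M) le' ->
     is_reduction M e v le N -> is_reduction M e v' le' N' ->
     g T N = g T N').
Proof.
subst n k.
have formula := fun v le N => @speyer_reduction R g hg T M e v le N n4 hM hMsplit he.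
split; first exact: formula.
move=> v v' le le' N N' vM v'M ord ord' redN redN'.
by rewrite (formula v le N) // (formula v' le' N').
Qed.
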